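(* Let $d>0$ be a prime and $n\geq 1$. Then $\Sigma(n,d)\cong C'(n,d)$ and $S(n,d)\cong C'(n,d)/\langle X\rangle$. If $d$ is a prime power that is not a prime, these isomorphisms also hold whenever $\gcd(n,d)=1$, but they do not always hold when $\gcd(n,d)\neq 1$.
   Context: For a prime power $q$ and $n\ge1$, let $X$ be the $n\times n$ matrix over $\mathbb{F}_q$ of multiplication by $x$ on $\mathbb{F}_q[x]/(x^n-1)$ in the basis $1,x,\dots,x^{n-1}$ (the permutation matrix of an $n$-cycle). $\mathbb{F}_q[X]$ is the algebra of $n\times n$ circulant matrices; $C(n,q)$ is its group of units and $C'(n,q)=\{C\in C(n,q): C\mathbf 1=\mathbf 1\}$, where $\mathbf 1$ is the all-ones vector; $\langle X\rangle\le C'(n,q)$ is the cyclic subgroup generated by $X$. For integers $n\ge1$, $d\ge2$: in $\mathbb{Q}[x]/(x^n-1)$ (exponents taken mod $n$) put $e_v=x^v-1$, $\epsilon_v=d\,e_v-e_{dv}$; let $\mathcal Z_n$ be the $\mathbb{Z}$-span of $e_1,\dots,e_{n-1}$ and $\mathcal E_{n,d}$ the $\mathbb{Z}$-span of $\epsilon_1,\dots,\epsilon_{n-1}$; $\Sigma(n,d)=\mathcal Z_n/\mathcal E_{n,d}$. Let $f_v=dx^v-\sum_{i=0}^{d-1}x^{dv+i}$ and $S(n,d)=\mathcal Z_n/\langle f_1,\dots,f_{n-1}\rangle_{\mathbb{Z}}$ (this group is isomorphic to the sandpile group of the generalized de Bruijn graph with vertex set $\mathbb{Z}_n$ and arcs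 $v\to dv+i$, $0\le i\le d-1$). *)

(* Defs.v *)
From HB Require Import structures.
From mathcomp Require Import all_boot all_order all_fingroup all_algebra.
From mathcomp Require Import generic_quotient ring_quotient qpoly.

Set Implicit Arguments.
Unset Strict Implicit.
Unset Printing Implicit Defensive.

Import GRing.Theory.
Local Open Scope ring_scope.

Section IntSpan.
Variables (V : vectType rat) (m : nat) (s : m.-tuple V).

Definition zspan : {pred V} := fun v => if dec_Qint_span s v then true else false.

Lemma zspanP v : reflect (inIntSpan s v) (v \in zspan).
Proof. by rewrite /zspan unfold_in; case: dec_Qint_span => ?; constructor. Qed.

Fact zspan_zmod_closed : zmod_closed zspan.
Proof.
split=> [|u v /zspanP[a ->] /zspanP[b ->]]; apply/zspanP.
  by exists 0; rewrite big1 // => i _; rewrite ffunE mulr0z.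
exists (a - b); rewrite -sumrB; apply: eq_bigr => i _.
by rewrite !ffunE mulrzBr.
Qed.
HB.instance Definition _ := GRing.isZmodClosed.Build V zspan zspan_zmod_closed.

Lemma mem_zspan v : v \in s -> v \in zspan.
Proof.
case/tnthP=> i ->; apply/zspanP; exists [ffun j => (j == i)%:R].
rewrite (bigD1 i) //= ffunE eqxx mulr1z -tnth_nth big1 ?addr0 // => j.
by rewrite ffunE => /negPf->; rewrite mulr0z.
Qed.

Record zspan_sub : predArgType := ZSpanSub { zspan_val : V; _ : zspan_val \in zspan }.
HB.instance Definition _ := [isSub for zspan_val].
HB.instance Definition _ := [Choice of zspan_sub by <:].
HB.instance Definition _ := [SubChoice_isSubZmodule of zspan_sub by <:].

End IntSpan.

Section IntSpanQuotient.
Variables (V : vectType rat) (m k : nat) (s : m.-tuple V) (t : k.-tuple V).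

Definition zspan_in : {pred zspan_sub s} := fun u => val u \in zspan t.

Fact zspan_in_zmod_closed : zmod_closed zspan_in.
Proof.
split=> [|u v]; first exact: (rpred0 (zspan t)).
exact: (@rpredB _ (zspan t) (val u) (val v)).
Qed.
HB.instance Definition _ :=
  GRing.isZmodClosed.Build (zspan_sub s) zspan_in zspan_in_zmod_closed.

(* <s>_Z / <t>_Z, for t inside <s>_Z *)
Definition zspan_quot : zmodType := Quotient.quot zspan_in.

End IntSpanQuotient.

(* For n > 0, K[x]/(x^n - 1), with 'qX the class of x *)
Notation cyc_alg K n := {poly %/ ('X^n - 1 : {poly K})}.

Section CyclicAlgebra.
Variables (K : fieldType) (n : nat).
Hypothesis n_gt0 : (0 < n)%N.

Lemma mk_monic_cyc : mk_monic ('X^n - 1 : {poly K}) = 'X^n - 1.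
Proof. by rewrite /mk_monic size_XnsubC // ltnS n_gt0 monicXnsubC. Qed.

Lemma qX_exp_n : ('qX : cyc_alg K n) ^+ n = 1.
Proof.
rewrite /= -rmorphXn /= -[LHS](subrK 1) -[X in _ - X + _](rmorph1 (in_qpoly _)).
rewrite -rmorphB /=; suff ->: in_qpoly ('X^n - 1 : {poly K}) ('X^n - 1) = 0 by rewrite add0r.
apply: val_inj => /=; rewrite mk_monic_cyc Pdiv.RingMonic.rmodpp //.
exact: monicXnsubC.
Qed.

Lemma qX_exp_mod k : ('qX : cyc_alg K n) ^+ (k %% n)%N = 'qX ^+ k.
Proof. by rewrite {2}(divn_eq k n) exprD mulnC exprM qX_exp_n expr1n mul1r. Qed.

Lemma coef_qX_exp k i : (('qX : cyc_alg K n) ^+ k)`_i = (i == k %% n)%N%:R.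
Proof.
rewrite -qX_exp_mod.
have -> : ('qX : cyc_alg K n) ^+ (k %% n)%N = in_qpoly _ 'X^(k %% n) by rewrite rmorphXn.
rewrite in_qpoly_small ?coefXn //.
by rewrite mk_monic_cyc size_XnsubC // size_polyXn ltnS ltn_pmod.
Qed.

End CyclicAlgebra.

Section SandpileQuotients.
Variables (n d : nat).

Local Notation x := ('qX : cyc_alg rat n).

Definition cyc_e (v : nat) : cyc_alg rat n := x ^+ v - 1.
Definition cyc_eps (v : nat) : cyc_alg rat n := cyc_e v *+ d - cyc_e (d * v)%N.
Definition cyc_f (v : nat) : cyc_alg rat n :=
  x ^+ v *+ d - \sum_(i < d) x ^+ (d * v + i)%N.

Definition e_gens := [tuple cyc_e i.+1 | i < n.-1].
Definition eps_gens := [tuple cyc_eps i.+1 | i < n.-1].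
Definition f_gens := [tuple cyc_f i.+1 | i < n.-1].

Definition Sigma : zmodType := zspan_quot e_gens eps_gens.
(* S(n,d) *)
Definition Sandpile : zmodType := zspan_quot e_gens f_gens.

Hypothesis n_gt0 : (0 < n)%N.

Lemma cyc_e_zspan v : cyc_e v \in zspan e_gens.
Proof.
rewrite /cyc_e -(qX_exp_mod rat n_gt0).
have : (v %% n < n)%N by rewrite ltn_pmod.
case: (v %% n)%N => [|k] k_lt; first by rewrite expr0 subrr rpred0.
have k_lt' : (k < n.-1)%N by rewrite -ltnS prednK.
by apply/mem_zspan/tnthP; exists (Ordinal k_lt'); rewrite tnth_mktuple.
Qed.

Lemma cyc_eps_zspan v : cyc_eps v \in zspan e_gens.
Proof. by rewrite rpredB ?rpredMn ?cyc_e_zspan. Qed.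

Lemma cyc_f_zspan v : cyc_f v \in zspan e_gens.
Proof.
suff -> : cyc_f v = cyc_e v *+ d - \sum_(i < d) cyc_e (d * v + i)%N.
  by rewrite rpredB ?rpredMn ?rpred_sum ?cyc_e_zspan // => i _; rewrite cyc_e_zspan.
rewrite /cyc_f /cyc_e sumrB mulrnBl big_const_ord iter_addr addr0.
by rewrite opprB addrA addrNK.
Qed.

End SandpileQuotients.

Section Circulant.
Variables (F : finFieldType) (n : nat).

(* Following {'GL_n[F]}, matrices have size n.-1.+1, which is n for n > 0. *)
Local Notation N := n.-1.+1.

(* Column j is x * x^j = x^(j+1 mod n), in the basis 1, x, .., x^(n-1). *)
Definition circ_X : 'M[F]_N := \matrix_(i, j) (i == ordS j)%:R.

Lemma circ_XE i j :
  circ_X i j = ('qX * 'qX ^+ j : cyc_alg F N)`_i.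
Proof. by rewrite mxE -exprS coef_qX_exp. Qed.

(* F[X]; coefficient vectors of size n suffice by Cayley-Hamilton, see circulantP *)
Definition circulant : {pred 'M[F]_N} :=
  fun A => [exists c : 'rV[F]_N, A == horner_mx circ_X (rVpoly c)].

Lemma circulantP A :
  reflect (exists p, A = horner_mx circ_X p) (A \in circulant).
Proof.
apply: (iffP existsP) => [[c /eqP->]|[p ->]]; first by exists (rVpoly c).
exists (poly_rV (p %% char_poly circ_X)); rewrite poly_rV_K; last first.
  by rewrite -ltnS -(size_char_poly circ_X) ltn_modp monic_neq0 ?char_poly_monic.
rewrite {1}(divp_eq p (char_poly circ_X)) rmorphD rmorphM /=.
by rewrite Cayley_Hamilton mulr0 add0r.
Qed.

(* C(n,q), the unit group of F[X]: the inverse is required to lie in F[X] too *)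
Definition circ_units := [set g : {'GL_n[F]} |
  (GLval g \in circulant) && (GLval g^-1%g \in circulant)].

(* C'(n,q) *)
Definition circ_units1 := [set g in circ_units |
  GLval g *m const_mx 1 == const_mx 1 :> 'cV[F]_N].

Fact circ_units_group_set : group_set circ_units.
Proof.
have circ1 : 1 \in circulant by apply/circulantP; exists 1; rewrite rmorph1.
have circM A B : A \in circulant -> B \in circulant -> A * B \in circulant.
  move=> /circulantP[p ->] /circulantP[q ->].
  by apply/circulantP; exists (p * q); rewrite rmorphM.
apply/group_setP; split=> [|g h]; first by rewrite inE invg1 GL_1E circ1.
by rewrite !inE invMg !GL_ME => /andP[? ?] /andP[? ?]; rewrite !circM.
Qed.
Canonical circ_units_group := Group circ_units_group_set.

Fact circ_units1_group_set : group_set circ_units1.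
Proof.
apply/group_setP; split=> [|g h].
  by rewrite inE group1 GL_1E mul1mx eqxx.
rewrite ![_ \in circ_units1]inE => /andP[Cg /eqP g1] /andP[Ch /eqP h1].
by rewrite groupM // GL_MxE -mulmxA h1 g1 eqxx.
Qed.
Canonical circ_units1_group := Group circ_units1_group_set.

Fact circ_X_unit : circ_X \is a GRing.unit.
Proof.
suff -> : circ_X = perm_mx (perm (@ordS_inj N))^-1%g by apply: unitmx_perm.
apply/matrixP=> i j; rewrite !mxE; congr (_%:R); congr nat_of_bool.
by rewrite -[RHS](inj_eq (@perm_inj _ (perm (@ordS_inj N)))) permKV permE.
Qed.

(* X as an element of C'(n,q) *)
Definition circ_gen : {'GL_n[F]} := FinRing.Unit circ_X_unit.

Lemma circ_gen_units1 : circ_gen \in circ_units1.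
Proof.
have GLX k : GLval (circ_gen ^+ k)%g = circ_X ^+ k.
  by elim: k => [|k IHk]; rewrite ?expg0 ?GL_1E // expgS GL_ME IHk exprS.
have circX k : GLval (circ_gen ^+ k)%g \in circulant.
  by apply/circulantP; exists 'X^k; rewrite GLX rmorphXn /= horner_mx_X.
rewrite !inE invg_expg circX -[X in GLval X \in _]expg1 circX /=.
apply/eqP/matrixP=> i j; rewrite !mxE (bigD1 (ord_pred i)) //= !mxE ord_predK.
rewrite eqxx mulr1 big1 ?addr0 // => k /eqP k_neq; rewrite !mxE.
by case: eqP => [ik|]; rewrite ?mul0r //; case: k_neq; rewrite ik ordSK.
Qed.

Lemma circ_units1_abelian : abelian circ_units1.
Proof.
apply/centsP=> g; rewrite !inE => /andP[/andP[/circulantP[p gE] _] _].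
move=> h; rewrite !inE => /andP[/andP[/circulantP[q hE] _] _].
have gh : GLval (g * h)%g = GLval (h * g)%g.
  by rewrite !GL_ME gE hE; apply: comm_horner_mx2.
exact: val_inj gh.
Qed.

Lemma circ_gen_normal : (<[circ_gen]> <| circ_units1)%g.
Proof.
by rewrite -sub_abelian_normal ?cycle_subG ?circ_gen_units1 ?circ_units1_abelian.
Qed.

End Circulant.

Arguments circ_units F n : clear implicits.
Arguments circ_units1 F n : clear implicits.
Arguments circ_units1_group F n : clear implicits.
Arguments circ_gen F n : clear implicits.

(* A is written additively, G multiplicatively. *)
Definition zmod_isog (A : zmodType) (gT : finGroupType) (G : {group gT}) : Prop :=
  exists f : A -> gT,
    [/\ {morph f : x y / x + y >-> (x * y)%g}, injective f
      & forall g, g \in G <-> exists x, f x = g].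

(* Main.v *)
Require Import Defs.
From HB Require Import structures.
From mathcomp Require Import all_boot all_order all_fingroup all_algebra.
From mathcomp Require Import all_solvable all_field ring.
From mathcomp Require Import generic_quotient ring_quotient qpoly.

Set Implicit Arguments.
Unset Strict Implicit.
Unset Printing Implicit Defensive.

(* Let q = #|F|. Both groups of the paper are generated by elements E_v, v mod n, with
   E_0 = 0 and q E_v = sum_(i in o) E_(qv+i), where o = {0} for Sigma(n,q) and
   o = {0, .., q-1} for S(n,q).

   If gcd(n,q) = 1, choose a finite field K over F with a primitive n-th root of unity
   zeta. Then |K| - 1 kills both groups, so the Smith normal form of the relations
   identifies each of them with its group of K^*-valued characters. Evaluation at the
   powers of zeta identifies C'(n,q) with the maps y : Z/n -> K^* such that y 0 = 1 and
   y(qv) = y(v)^q, i.e. with the characters of Sigma(n,q); the characters of S(n,q) are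
   the maps v |-> y(v+1) / (y(v) y(1)), and these determine y up to the powers of X.

   If q = p is prime and n = n'p, reduction mod n' maps each group of level n onto the
   group of level n', with kernel the p-torsion. Hence by induction on n the two groups A
   and C satisfy pA ~ A/A[p] ~ C/C[p] ~ pC; as moreover |A[p]| = |A/pA| and |C[p]| agree,
   A and C are isomorphic.

   If q is a proper power of p, then C'(n,q) has exponent dividing n for n = p(q-1),
   while Sigma(n,q) and S(n,q) do not, as is seen from an explicit map to Z/q. *)

(** * Abelian groups with equally many solutions of x ^ N = 1 *)

Section AbelianCounting.
Import GroupScope.

(** When p divides n, X^n - 1 has repeated roots, so evaluation at roots of unity no longer
    separates circulants, and no map between the two groups is constructed. The step from n to np
    compares them only through their numbers of solutions of x ^ N = 1, which determine a finite
    abelian group; even finiteness of the presented group comes out of the induction. The step links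
    two operations: the relations multiply by q, while X^(np) - 1 = (X^n - 1)^p is reached by p-th
    powers. They match only when q = p.

    In the coprime case the characters describe the dual of A rather than A itself. The isomorphism
    of a finite abelian group with its dual depends on choices, and the Smith normal form supplies
    them.

    The level p(q - 1) comes from X^(q-1) - 1 splitting over F: units modulo it have exponent
    dividing q - 1, and the p-th power of this modulus costs a factor p. A proper power q of p does
    not divide p(q - 1), so this multiple of 1 is nonzero in Z/q; for q = p it would vanish. *)

Lemma card_Ldiv_dprod (gT : finGroupType) (A B G : {group gT}) N :
  abelian G -> A \x B = G -> #|'Ldiv_N(G)| = (#|'Ldiv_N(A)| * #|'Ldiv_N(B)|)%N.
Proof.
move=> cGG defG; have [_ defAB cAB tiAB] := dprodP defG.
have sAG : A \subset G by rewrite -defAB mulG_subl.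
have sBG : B \subset G by rewrite -defAB mulG_subr.
pose LA := Group (group_Ldiv N (abelianS sAG cGG)).
pose LB := Group (group_Ldiv N (abelianS sBG cGG)).
have cXg x y : x \in A -> y \in B -> (x * y) ^+ N = x ^+ N * y ^+ N.
  move=> Ax By; rewrite expgMn //.
  by apply: (centsP cGG); [apply: (subsetP sAG) | apply: (subsetP sBG)].
rewrite -[RHS](@TI_cardMg _ LA LB); last first.
  by apply/trivgP; rewrite -tiAB setISS ?subsetIl.
congr #|pred_of_set _|; apply/setP=> z; apply/LdivP/mulsgP.
  case; rewrite -defAB => /mulsgP[x y Ax By ->]; rewrite cXg // => xy1.
  have xN : x ^+ N = 1.
    have : x ^+ N \in A :&: B.
      by rewrite inE groupX //= -(mulgK (y ^+ N) (x ^+ N)) xy1 mul1g groupV groupX.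
    by rewrite tiAB => /set1P.
  have yN : y ^+ N = 1 by rewrite xN mul1g in xy1.
  by exists x y; rewrite // !inE ?Ax ?By ?xN ?yN /=.
case=> x y /LdivP[Ax xN] /LdivP[By yN] ->; rewrite cXg // xN yN mulg1.
by rewrite -defAB mem_mulg.
Qed.

Lemma card_Ldiv_isog (gT rT : finGroupType) (G : {group gT}) (H : {group rT}) N :
  G \isog H -> #|'Ldiv_N(G)| = #|'Ldiv_N(H)|.
Proof.
by case/isogP=> f injf <-; rewrite -(injm_Ldiv injf) // card_injm ?subsetIl.
Qed.

(** Induction on |G|. The counts reveal order and exponent, since ['Ldiv_N(K)] is all of K exactly
    when the exponent of K divides N. A cyclic factor whose order is the exponent splits off from
    each group, and its count cancels from the product. *)
Lemma isog_card_Ldiv (gT rT : finGroupType) (G : {group gT}) (H : {group rT}) :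
  abelian G -> abelian H ->
  (forall N, 0 < N -> #|'Ldiv_N(G)| = #|'Ldiv_N(H)|) -> G \isog H.
Proof.
have [m] := ubnP #|G|; elim: m G H => // m IHm G H leGm cGG cHH eqL.
have full_exp (kT : finGroupType) (K : {group kT}) N :
  (#|'Ldiv_N(K)| == #|K|) = (exponent K %| N).
  rewrite -sub_Ldiv; apply/idP/idP=> [eqLK|sKL].
    have /eqP-> : 'Ldiv_N(K) == K by rewrite eqEcard subsetIl (eqP eqLK) /=.
    exact: subxx.
  by rewrite eqn_leq subset_leq_card ?subsetIl //= subset_leq_card.
have eqGH : #|G| = #|H|.
  have N0 : 0 < #|G| * #|H| by rewrite muln_gt0 !cardG_gt0.
  have := eqL _ N0; have /eqP-> : #|'Ldiv_(#|G| * #|H|)(G)| == #|G|.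
    by rewrite full_exp dvdn_mulr ?exponent_dvdn.
  by move=> ->; apply/eqP; rewrite full_exp dvdn_mull ?exponent_dvdn.
have eq_exp : exponent G = exponent H.
  apply/eqP; rewrite eqn_dvd -full_exp eqL ?exponent_gt0 // eqGH full_exp dvdnn /=.
  by rewrite -full_exp -eqL ?exponent_gt0 // -eqGH full_exp dvdnn.
have [trG|ntG] := eqVneq G 1%G.
  rewrite isog_cyclic_card ?trG ?cyclic1 //.
  have /eqP trH : H :==: 1 by rewrite trivg_card1 -eqGH trG cards1.
  by rewrite trH cyclic1 !cards1.
have [K /(_ cGG)[x ox defG]] := abelian_type_subproof G.
have [K' /(_ cHH)[y oy defH]] := abelian_type_subproof H.
have isoxy : <[x]> \isog <[y]>.
  by rewrite isog_cyclic_card ?cycle_cyclic //= -!orderE ox oy eq_exp.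
apply: (isog_dprod defG defH isoxy); apply: IHm.
- have := dprod_card defG; rewrite -orderE ox => defc.
  rewrite -ltnS; apply: leq_trans leGm; rewrite ltnS -defc ltn_Pmull ?cardG_gt0 //.
  rewrite ltn_neqAle exponent_gt0 eq_sym -dvdn1 -trivg_exponent andbT.
  by apply: contra ntG => /eqP trG; apply/eqP/val_inj.
- by apply: abelianS cGG; have [_ <- _ _] := dprodP defG; apply: mulG_subr.
- by apply: abelianS cHH; have [_ <- _ _] := dprodP defH; apply: mulG_subr.
move=> N N0; have := eqL N N0; rewrite (card_Ldiv_dprod _ cGG defG).
rewrite (card_Ldiv_dprod _ cHH defH) (card_Ldiv_isog _ isoxy) => /eqP.
rewrite eqn_pmul2l => [/eqP //|]; rewrite card_gt0; apply/set0Pn; exists 1.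
by rewrite !inE group1 expg1n eqxx.
Qed.

(** As f kills exactly G[p], x^(pM) = 1 amounts to (f x)^M = 1. If p does not divide N, then G[N]
    meets G[p] trivially and f maps G[N] bijectively onto the N-torsion of the image. *)
Lemma card_Ldiv_morph (gT rT : finGroupType) (G : {group gT})
    (f : {morphism G >-> rT}) p N :
  abelian G -> prime p -> 'ker f = 'Ldiv_p(G) ->
  #|'Ldiv_N(G)| = if p %| N then (#|'Ldiv_p(G)| * #|'Ldiv_(N %/ p)(f @* G)|)%N
                  else #|'Ldiv_N(f @* G)|.
Proof.
move=> cGG p_pr kerf; have cfG := morphim_abelian f cGG.
have ker_fx x : x \in G -> (f x == 1) = (x ^+ p == 1).
  move=> Gx; apply/idP/idP => [/eqP fx1|/eqP xp].
    by have: x \in 'ker f; [apply/kerP | rewrite kerf => /LdivP[_ ->]].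
  by apply/eqP/mker; rewrite kerf; apply/LdivP.
case: ifPn => [/dvdnP[M ->]|pN].
  rewrite mulnK ?prime_gt0 // -kerf.
  rewrite -(@card_morphpre _ _ _ f (Group (group_Ldiv M cfG))) ?subsetIl //=.
  congr #|pred_of_set _|; apply/setP=> x; rewrite !inE.
  case Gx: (x \in G) => //=; rewrite mem_morphim //= -morphX //.
  by rewrite ker_fx ?groupX // expgM.
have copN : coprime p N by rewrite prime_coprime.
have -> : 'Ldiv_N(f @* G) = f @: 'Ldiv_N(G).
  apply/setP=> z; apply/LdivP/imsetP.
    case=> /morphimP[x Gx _ ->] fxN.
    (* An exponent that is 0 modulo p and 1 modulo N moves a preimage into G[N] without changing its
       image. *)
    have /chinese_modl ch := copN; have /chinese_modr ch' := copN.
    exists (x ^+ chinese p N 0 1).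
      apply/LdivP; split; first by rewrite groupX.
      have /dvdnP[k ->] : p %| chinese p N 0 1 by rewrite /dvdn ch mod0n.
      have : f (x ^+ N) == 1 by rewrite morphX ?fxN.
      rewrite ker_fx ?groupX // -expgM mulnC => /eqP pN1.
      by rewrite -expgM -mulnA mulnC expgM pN1 expg1n.
    by rewrite morphX // -(expg_mod (chinese p N 0 1) fxN) ch' expg_mod.
  case=> x /LdivP[Gx xN] ->; rewrite mem_morphim //; split=> //.
  by rewrite -morphX // xN morph1.
rewrite card_in_imset // => x y /LdivP[Gx xN] /LdivP[Gy yN] /eqP.
rewrite eq_mulgV1 -morphV // -morphM ?groupV // ker_fx ?groupM ?groupV // => /eqP xyp.
have: #[x * y^-1] %| gcdn p N.
  rewrite dvdn_gcd !order_dvdn xyp eqxx /= expgMn ?expVgn ?xN ?yN ?invg1 ?mulg1 //.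
  by apply: (centsP cGG); rewrite ?groupV.
by rewrite (eqP copN) dvdn1 order_eq1 => /eqP/(canRL (mulgKV _)); rewrite mul1g.
Qed.

(* G/G[p] ~ pG determines the type of G except for the number of cyclic factors of
   order p, and |G[p]| recovers that number. *)
Lemma isog_morph_Ldiv (gT hT rT sT : finGroupType) (G : {group gT}) (H : {group hT})
    (f : {morphism G >-> rT}) (h : {morphism H >-> sT}) p :
  abelian G -> abelian H -> prime p ->
  'ker f = 'Ldiv_p(G) -> 'ker h = 'Ldiv_p(H) ->
  f @* G \isog h @* H -> #|'Ldiv_p(G)| = #|'Ldiv_p(H)| -> G \isog H.
Proof.
move=> cGG cHH p_pr kerf kerh iso_fh eqp; apply: isog_card_Ldiv => // N N0.
rewrite (card_Ldiv_morph N cGG p_pr kerf) (card_Ldiv_morph N cHH p_pr kerh).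
by case: ifP => _; rewrite ?eqp (card_Ldiv_isog _ iso_fh).
Qed.

End AbelianCounting.

Import GRing.Theory Num.Theory.
Local Open Scope ring_scope.

(** * Additive groups exhausted by a finite list *)

Section FiniteZmodule.
Variables (A : zmodType) (s : seq A).
Hypothesis sP : forall a, a \in s.

(** An alias of [A] on which a finite type structure can be declared, so that finite group theory
    applies to it. The proof stays in the type to let instance inference recover the list. *)
Definition enum_zmod of (forall a, a \in s) : Type := A.
Local Notation B := (enum_zmod sP).

HB.instance Definition _ := GRing.Zmodule.on B.

Fact enum_zmod_pcancel :
  pcancel (fun a : B => index a s) (fun i => nth None (map some s) i).
Proof.
by move=> a; rewrite (nth_map a) ?index_mem ?nth_index ?(sP a) //.
Qed.
HB.instance Definition _ := PCanIsCountable enum_zmod_pcancel.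

Fact enum_zmod_finite : Finite.axiom (undup s : seq B).
Proof. by move=> a; rewrite count_uniq_mem ?undup_uniq // mem_undup (sP a). Qed.
HB.instance Definition _ := isFinite.Build B enum_zmod_finite.

End FiniteZmodule.

Section ZmodIsog.

Lemma zmod_isog_trans (A : zmodType) (gT rT : finGroupType)
    (G : {group gT}) (H : {group rT}) :
  zmod_isog A G -> (G \isog H)%g -> zmod_isog A H.
Proof.
case=> f [fM f_inj fG] /isogP[h /injmP h_inj hG]; exists (h \o f).
have Gf a : f a \in G by apply/fG; exists a.
split=> [x y /=|x y /= /h_inj hxy|g].
- by rewrite fM morphM.
- by apply/f_inj/hxy.
rewrite -hG; split=> [/morphimP[x Gx _ ->]|[x <-]]; last exact: mem_morphim.
by have/fG[a fa] := Gx; exists a; rewrite /= fa.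
Qed.

Variables (A : zmodType) (gT rT : finGroupType) (G : {group gT}) (G' : {group rT}).
Variables (s : seq A) (p : nat) (C : finZmodType).
Variables (r : A -> rT) (h : gT -> rT) (k : A -> C).

(** [r] and [h] have kernels A[p] and G[p] and the common image G', while [k] identifies A/pA with
    C. Since |A[p]| = |A/pA| for finite A, the last hypothesis says |G[p]| = |A[p]|. *)
Lemma zmod_isog_torsion :
    (forall a, a \in s) -> prime p -> abelian G ->
    {morph r : x y / x + y >-> (x * y)%g} ->
    (forall g, g \in G' <-> exists a, r a = g) ->
    (forall a, r a = 1%g -> a *+ p = 0) -> (forall a, a *+ p = 0 -> r a = 1%g) ->
    {in G &, {morph h : x y / (x * y)%g}} -> h @: G = G' ->
    {in G, forall g, h g = 1%g -> (g ^+ p)%g = 1%g} ->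
    {in G, forall g, (g ^+ p)%g = 1%g -> h g = 1%g} ->
    {morph k : x y / x + y} -> (forall c, exists a, k a = c) ->
    (forall a, k a = 0 -> exists b, a = b *+ p) -> (forall b, k (b *+ p) = 0) ->
    #|'Ldiv_p(G)%g| = #|C| ->
  zmod_isog A G.
Proof.
move=> sP p_pr cGG rM rG' r1 r1' hM hG' h1 h1' kM ksurj k0 k0' cardG.
pose B : finZmodType := enum_zmod sP.
pose rm := @Morphism B rT setT r (in2W rM).
pose hm := Morphism hM.
pose km := @Morphism B C setT k (in2W kM).
pose pm := @Morphism B B setT (fun x => x *+ p) (in2W (fun x y => mulrnDl p x y)).
have cBB : abelian [set: B] by apply: FinRing.zmod_abelian.
have LdivB (x : B) : (x \in 'Ldiv_p([set: B])%g) = (x *+ p == 0).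
  by rewrite !inE /= FinRing.zmodXgE.
have kerr : ('ker rm = 'Ldiv_p([set: B]))%g.
  apply/setP=> x; rewrite LdivB; apply/idP/eqP=> [/mker/r1 //|xp0].
  by apply/kerP; rewrite ?inE //=; apply: r1'.
have kerh : ('ker hm = 'Ldiv_p(G))%g.
  apply/setP=> x; apply/idP/LdivP=> [xk|[Gx xp]].
    by have Gx := dom_ker xk; split=> //; apply: h1 => //; have := mker xk.
  by apply/kerP=> //=; apply: h1'.
have kerp : ('ker pm = 'Ldiv_p([set: B]))%g.
  apply/setP=> x; rewrite LdivB; apply/idP/eqP=> [/mker //|xp0].
  by apply/kerP; rewrite ?inE.
have imp : (pm @* [set: B] = 'ker km)%g.
  apply/setP=> x; apply/morphimP/idP=> [[y _ _ ->]|/mker/k0[b ->]].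
    by apply/kerP; rewrite ?inE //=; apply: k0'.
  by exists b; rewrite ?inE.
have imk : (km @* [set: B] = [set: C])%g.
  apply/setP=> x; rewrite inE; apply/morphimP.
  by have [a <-] := ksurj x; exists a; rewrite ?inE.
have isoBG : ([set: B] \isog G)%g.
  apply: (isog_morph_Ldiv cBB cGG p_pr kerr kerh).
    suff -> : (rm @* setT = hm @* G)%g by apply: isog_refl.
    rewrite [RHS]morphimEdom hG'; apply/setP=> g; apply/morphimP/idP.
      by case=> a _ _ ->; apply/rG'; exists a.
    by case/rG'=> a <-; exists a; rewrite ?inE.
  (* Both products count A: |A[p]| |pA| = |A| = |pA| |A/pA|. *)
  have c1 : (#|('ker pm)%g| * #|(pm @* setT)%g| = #|[set: B]|)%N.
    by rewrite card_morphim setTI Lagrange ?subsetT.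
  have c2 : (#|('ker km)%g| * #|(km @* setT)%g| = #|[set: B]|)%N.
    by rewrite card_morphim setTI Lagrange ?subsetT.
  rewrite cardG -cardsT -imk -kerp; apply/eqP.
  by rewrite -(eqn_pmul2r (cardG_gt0 (pm @* setT)%G)) c1 mulnC /= imp c2.
apply: zmod_isog_trans isoBG; exists id; split=> // g.
by rewrite inE; split=> // _; exists g.
Qed.

End ZmodIsog.

(** * Generators and relations *)

(* This is Sigma(n,d) for o = [:: 0] and S(n,d) for o = iota 0 d. As E 0 = 0, pres_ker
   leaves the coefficient c 0 unconstrained. *)
Record presentation (n d : nat) (o : seq nat) (A : zmodType) (E : nat -> A) : Prop :=
  Presentation {
    pres0 : E 0 = 0;
    pres_mod : forall v, E (v %% n)%N = E v;
    pres_rel : forall v, E v *+ d = \sum_(i <- o) E (d * v + i)%N;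
    pres_gen : forall a, exists c : nat -> int, a = \sum_(v < n) E v *~ c v;
    pres_ker : forall c : nat -> int, \sum_(v < n) E v *~ c v = 0 ->
      exists b : nat -> int, forall w, (0 < w < n)%N ->
        c w = b w *+ d - \sum_(v < n) \sum_(i <- o) b v *+ ((d * v + i) %% n == w)%N }.

Section PresentationTheory.
Variables (n d : nat) (o : seq nat) (n_gt0 : (0 < n)%N).

Lemma sum_periodic_delta (A : zmodType) (g : nat -> A) (b : int) u :
  (forall v, g (v %% n)%N = g v) ->
  \sum_(w < n) g w *~ (b *+ (u %% n == w)%N) = g u *~ b.
Proof.
move=> g_mod; have u_lt : (u %% n < n)%N by rewrite ltn_pmod.
rewrite (bigD1 (Ordinal u_lt)) //= eqxx mulr1n g_mod big1 ?addr0 // => w.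
by rewrite eq_sym -val_eqE /= => /negPf->; rewrite mulr0n mulr0z.
Qed.

(** The converse of [pres_ker], in any group whose elements [g v] satisfy the relations. *)
Lemma sum_relations0 (A : zmodType) (g : nat -> A) (c b : nat -> int) :
  g 0%N = 0 -> (forall v, g (v %% n)%N = g v) ->
  (forall v, g v *+ d = \sum_(i <- o) g (d * v + i)%N) ->
  (forall w, (0 < w < n)%N -> c w =
    b w *+ d - \sum_(v < n) \sum_(i <- o) b v *+ ((d * v + i) %% n == w)%N) ->
  \sum_(v < n) g v *~ c v = 0.
Proof.
move=> g0 g_mod g_rel c_b.
rewrite (eq_bigr (fun w : 'I_n => g w *~ (b w *+ d) -
   \sum_(v < n) \sum_(i <- o) g w *~ (b v *+ ((d * v + i) %% n == w)%N))); last first.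
  move=> w _; have [w0|w_gt0] := posnP w.
    rewrite w0 g0 !mul0rz sub0r big1 ?oppr0 // => v _.
    by rewrite big1 // => i _; rewrite mul0rz.
  rewrite c_b ?w_gt0 ?ltn_ord // mulrzBr; congr (_ - _).
  rewrite mulrz_sumr; apply: eq_bigr => v _.
  by rewrite mulrz_sumr.
rewrite sumrB; apply/eqP; rewrite subr_eq0; apply/eqP.
rewrite exchange_big /=; apply: eq_bigr => v _; rewrite exchange_big /=.
rewrite (eq_bigr (fun i => g (d * v + i)%N *~ b v)); last first.
  by move=> i _; apply: sum_periodic_delta.
by rewrite -mulrz_suml -g_rel pmulrn -mulr_natl natz mulrzA.
Qed.

(** The universal property. The image of [a] is computed from a chosen coefficient vector; by
    [pres_ker] two vectors for the same [a] differ by a combination of relations, on which [g]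
    vanishes. *)
Lemma presentation_lift (A B : zmodType) (E : nat -> A) (g : nat -> B) :
  presentation n d o E ->
  g 0%N = 0 -> (forall v, g (v %% n)%N = g v) ->
  (forall v, g v *+ d = \sum_(i <- o) g (d * v + i)%N) ->
  exists h : {additive A -> B}, forall v, h (E v) = g v.
Proof.
move=> presE g0 g_mod g_rel.
have gen (a : A) : exists c : {ffun 'I_n -> int}, a == \sum_(v < n) E v *~ c v.
  have [c ->] := pres_gen presE a; exists [ffun v : 'I_n => c v].
  by apply/eqP/eq_bigr => v _; rewrite ffunE.
pose h a := \sum_(v < n) g v *~ xchoose (gen a) v.
have hE (c : nat -> int) : h (\sum_(v < n) E v *~ c v) = \sum_(v < n) g v *~ c v.
  set a := \sum_(v < n) _; have /eqP := xchooseP (gen a); rewrite -/(h a).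
  set x := xchoose _ => a_x; pose c' i := c i - if insub i is Some j then x j else 0.
  have c'E (v : 'I_n) : c' v = c v - x v by rewrite /c' valK.
  have := pres_ker presE (c := c').
  rewrite (eq_bigr (fun v : 'I_n => E v *~ c v - E v *~ x v)); last first.
    by move=> v _; rewrite c'E mulrzBr.
  rewrite sumrB -a_x subrr => /(_ erefl)[b c'b].
  have := sum_relations0 g0 g_mod g_rel c'b.
  rewrite (eq_bigr (fun v : 'I_n => g v *~ c v - g v *~ x v)); last first.
    by move=> v _; rewrite c'E mulrzBr.
  by rewrite sumrB => /eqP; rewrite subr_eq0 => /eqP->.
have h_morph : zmod_morphism h.
  move=> x y; have [cx ->] := pres_gen presE x; have [cy ->] := pres_gen presE y.
  rewrite -sumrB (eq_bigr (fun v : 'I_n => E v *~ (cx v - cy v))); last first.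
    by move=> v _; rewrite mulrzBr.
  rewrite (hE (fun v => cx v - cy v)) !hE -sumrB; apply: eq_bigr => v _.
  by rewrite mulrzBr.
pose hm := GRing.isZmodMorphism.Build _ _ h h_morph.
pose ha : {additive A -> B} := HB.pack h hm.
exists ha => v; rewrite -[E v]mulr1z -(sum_periodic_delta 1 v (pres_mod presE)) /=.
by rewrite [LHS](hE (fun w => 1 *+ (v %% n == w)%N)) sum_periodic_delta.
Qed.

End PresentationTheory.

(** * The two groups as presented abelian groups *)

Section SpanQuotient.
Variables (V : vectType rat) (m k : nat) (s : m.-tuple V) (t : k.-tuple V).

Definition zspan_pi (u : zspan_sub s) : zspan_quot s t :=
  (\pi_(Quotient.quot (zspan_in (s := s) t)) u)%qT.

Fact zspan_pi_zmod_morphism : zmod_morphism zspan_pi.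
Proof.
move=> u v; rewrite /zspan_pi.
by rewrite (Quotient.pi_add (zspan_in (s := s) t)) (Quotient.pi_opp (zspan_in (s := s) t)).
Qed.
HB.instance Definition _ :=
  GRing.isZmodMorphism.Build _ _ zspan_pi zspan_pi_zmod_morphism.

Lemma zspan_pi_surj a : exists u, zspan_pi u = a.
Proof. by exists (repr a); rewrite /zspan_pi reprK. Qed.

Lemma zspan_pi_eq0 u : (zspan_pi u == 0) = (val u \in zspan t).
Proof.
rewrite -[0](raddf0 zspan_pi) /zspan_pi -Quotient.idealrBE subr0.
by rewrite unfold_in.
Qed.

End SpanQuotient.

Section SandpilePresentations.
Variables (n d : nat) (o : seq nat) (n_gt0 : (0 < n)%N).

(** A common form of [cyc_eps] and [cyc_f]: for [o = iota 0 d], replacing every power x^u by x^u - 1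
    subtracts d ones and adds d ones back. *)
Definition cyc_rel v : cyc_alg rat n :=
  cyc_e n v *+ d - \sum_(i <- o) cyc_e n (d * v + i).

Definition cyc_coef w (q : cyc_alg rat n) : rat := (q : {poly rat})`_w.

Fact cyc_coef_zmod_morphism w : zmod_morphism (cyc_coef w).
Proof. by move=> u v; rewrite /cyc_coef coefB. Qed.
HB.instance Definition _ w :=
  GRing.isZmodMorphism.Build _ _ (cyc_coef w) (cyc_coef_zmod_morphism w).

Variable t : (n.-1).-tuple (cyc_alg rat n).
Hypothesis t_rel : forall i : 'I_n.-1, tnth t i = cyc_rel i.+1.

Local Notation A := (zspan_quot (e_gens n) t).

Definition quot_gen v : A := zspan_pi t (ZSpanSub (cyc_e_zspan n_gt0 v)).

Lemma cyc_e_mod v : cyc_e n (v %% n)%N = cyc_e n v.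
Proof. by rewrite /cyc_e qX_exp_mod. Qed.

Lemma quot_gen_mod v : quot_gen (v %% n)%N = quot_gen v.
Proof. by congr zspan_pi; apply: val_inj; rewrite /= cyc_e_mod. Qed.

Lemma quot_gen0 : quot_gen 0%N = 0.
Proof.
apply/eqP; rewrite zspan_pi_eq0 /= /cyc_e expr0 subrr; exact: rpred0.
Qed.

(** Positive coefficients do not see the constant term of [cyc_e], so they are the coordinates in
    the basis e_1, ..., e_(n-1). This is why [pres_ker] speaks of positive w only. *)
Lemma coef_cyc_e v w : (0 < w)%N -> cyc_coef w (cyc_e n v) = (v %% n == w)%N%:R.
Proof.
move=> w_gt0; rewrite /cyc_e /cyc_coef coefB coef_qX_exp // eq_sym.
have := coef_qX_exp rat n_gt0 0 w; rewrite expr0 => ->.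
by rewrite mod0n eqn0Ngt w_gt0 subr0.
Qed.

Lemma quot_gen_rel v : (0 < v %% n)%N ->
  quot_gen v *+ d = \sum_(i <- o) quot_gen (d * v + i)%N.
Proof.
move=> v_gt0; apply/eqP; rewrite -subr_eq0 /quot_gen -raddfMn -raddf_sum -raddfB.
rewrite zspan_pi_eq0 raddfB raddfMn raddf_sum /=.
have -> : cyc_e n v *+ d - \sum_(i <- o) cyc_e n (d * v + i) = cyc_rel (v %% n)%N.
  rewrite /cyc_rel cyc_e_mod; congr (_ - _); apply: eq_bigr => i _.
  by rewrite -cyc_e_mod -[RHS]cyc_e_mod -modnDml -modnMmr modnDml.
apply/mem_zspan/tnthP.
have v_lt : ((v %% n).-1 < n.-1)%N.
  by rewrite -ltnS prednK // prednK // ltn_pmod.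
by exists (Ordinal v_lt); rewrite t_rel /= prednK.
Qed.

Lemma sum_from1 (B : zmodType) (F : nat -> B) :
  F 0%N = 0 -> \sum_(v < n) F v = \sum_(i < n.-1) F i.+1.
Proof.
by move=> F0; rewrite -(prednK n_gt0) big_ord_recl /= F0 add0r.
Qed.

(** The tuple [t] contains the relations for v = 1, ..., n-1 only; the hypothesis supplies the one
    at v = 0. *)
Lemma quot_presentation :
  \sum_(i <- o) quot_gen i = 0 -> presentation n d o quot_gen.
Proof.
move=> rel0; split; [exact: quot_gen0 | exact: quot_gen_mod | | | ].
- move=> v; have [v0|] := posnP (v %% n)%N; last exact: quot_gen_rel.
  rewrite -[quot_gen v]quot_gen_mod v0 quot_gen0 mul0rn -[LHS]rel0.
  apply: eq_bigr => i _; rewrite -[RHS]quot_gen_mod -modnDml -modnMmr v0.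
  by rewrite muln0 mod0n add0n quot_gen_mod.
- move=> a; have [u <-] := zspan_pi_surj a.
  have /zspanP[c u_c] := valP u.
  pose c' i := if insub i.-1 is Some j then c j else 0.
  exists c'; rewrite (sum_from1 (F := fun v => quot_gen v *~ c' v)); last first.
    by rewrite quot_gen0 mul0rz.
  transitivity (zspan_pi t (\sum_(i < n.-1) ZSpanSub (cyc_e_zspan n_gt0 i.+1) *~ c i)).
    congr zspan_pi; apply: val_inj; rewrite u_c raddf_sum; apply: eq_bigr => i _.
    by rewrite raddfMz -tnth_nth tnth_mktuple.
  by rewrite raddf_sum; apply: eq_bigr => i _; rewrite raddfMz /c' /= valK.
move=> c; rewrite (eq_bigr (fun v : 'I_n =>
    zspan_pi t (ZSpanSub (cyc_e_zspan n_gt0 v) *~ c v))); last first.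
  by move=> v _; rewrite raddfMz.
rewrite -raddf_sum => /eqP; rewrite zspan_pi_eq0 raddf_sum.
rewrite (eq_bigr (fun v : 'I_n => cyc_e n v *~ c v)); last first.
  by move=> v _; rewrite raddfMz.
case/zspanP=> b cb.
(* Position j of [t] holds the relation of j + 1; the relation of 0 gets coefficient 0. *)
pose b' i := if i is j.+1 then (if insub j is Some j' then b j' else 0) else 0.
exists b' => w /andP[w_gt0 w_lt].
move/(congr1 (cyc_coef w)): cb => cb; rewrite !raddf_sum in cb; move: cb.
rewrite (bigD1 (Ordinal w_lt)) //= (raddfMz (cyc_coef w)) /= coef_cyc_e // modn_small //.
rewrite eqxx big1 ?addr0 => [|v]; last first.
  rewrite -val_eqE /= => /negPf vw; rewrite (raddfMz (cyc_coef w)) /=.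
  by rewrite coef_cyc_e // modn_small // vw mul0rz.
(* The coefficient of x^w in the relation of v, kept as an integer so that the identity in [rat] can
   be pulled back to [int]. *)
pose K v : int := (v == w)%N%:R *+ d - \sum_(i <- o) ((d * v + i) %% n == w)%N%:R.
have coef_rel v : (v < n)%N -> cyc_coef w (cyc_rel v) = (K v)%:~R.
  move=> v_lt; rewrite /cyc_rel raddfB raddfMn raddf_sum /= coef_cyc_e //.
  rewrite modn_small // rmorphB rmorphMn /= rmorph_nat; congr (_ - _).
  by rewrite rmorph_sum; apply: eq_bigr => i _; rewrite coef_cyc_e // rmorph_nat.
rewrite (eq_bigr (fun i : 'I_n.-1 => (K i.+1 * b' i.+1)%:~R)); last first.
  move=> i _; rewrite (raddfMz (cyc_coef w)) /= -tnth_nth t_rel coef_rel; last first.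
    by rewrite -[X in (_ < X)%N](prednK n_gt0) ltnS.
  by rewrite /b' valK mulrzA.
rewrite -(sum_from1 (F := fun v => (K v * b' v)%:~R)) ?mulr0 //.
rewrite -rmorph_sum /= => /intr_inj ->.
rewrite (eq_bigr (fun v : 'I_n => (b' v *+ (v == w :> nat)) *+ d -
   \sum_(i <- o) b' v *+ ((d * v + i) %% n == w)%N)); last first.
  move=> v _; rewrite /K mulrBl mulrnAl mulr_natl; congr (_ - _).
  by rewrite mulr_suml; apply: eq_bigr => i _; rewrite mulr_natl.
rewrite sumrB; congr (_ - _); rewrite (bigD1 (Ordinal w_lt)) //= eqxx mulr1n.
by rewrite big1 ?addr0 // => v; rewrite -val_eqE /= => /negPf->; rewrite mul0rn.
Qed.


End SandpilePresentations.

Lemma sum_nat_blocks (B : zmodType) (F : nat -> B) n k :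
  \sum_(u < n * k) F u = \sum_(v < n) \sum_(i < k) F (v * k + i)%N.
Proof.
rewrite -(big_mkord xpredT F) big_nat_mul big_mkord; apply: eq_bigr => v _.
rewrite -[(v * k)%N in LHS]add0n big_addn mulSn addnK big_mkord.
by apply: eq_bigr => i _; rewrite addnC.
Qed.

Lemma Sigma_presentation n d :
  (0 < n)%N -> exists E : nat -> Sigma n d, presentation n d [:: 0%N] E.
Proof.
move=> n_gt0; exists (quot_gen n_gt0 (eps_gens n d)); apply: quot_presentation.
  by move=> i; rewrite tnth_mktuple /cyc_rel big_seq1 addn0.
by rewrite big_seq1 quot_gen0.
Qed.

Lemma Sandpile_presentation n d :
  (0 < n)%N -> exists E : nat -> Sandpile n d, presentation n d (iota 0 d) E.
Proof.
move=> n_gt0; pose E := quot_gen n_gt0 (f_gens n d).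
have t_rel (i : 'I_n.-1) : tnth (f_gens n d) i = cyc_rel n d (iota 0 d) i.+1.
  rewrite tnth_mktuple /cyc_rel /cyc_f /cyc_e -[d in iota 0 d]subn0.
  rewrite big_mkord sumrB mulrnBl big_const_ord iter_addr addr0.
  by rewrite opprB addrA addrNK.
exists E; apply: (quot_presentation t_rel).
have E_mod v : E (v %% n)%N = E v by apply: quot_gen_mod.
(* The numbers dv + i with v < n and i < d meet every residue modulo n exactly d times, so the n
   relations add up to an identity. The relation at 0 thus follows from the others. *)
have sum_all : \sum_(v < n) \sum_(i <- iota 0 d) E (d * v + i)%N = \sum_(v < n) E v *+ d.
  transitivity (\sum_(u < d * n) E u).
    rewrite mulnC sum_nat_blocks; apply: eq_bigr => v _.
    by rewrite -[d in iota 0 d]subn0 big_mkord; apply: eq_bigr => i _; rewrite mulnC.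
  rewrite sum_nat_blocks (eq_bigr (fun _ => \sum_(v < n) E v)) => [|j _].
    by rewrite sumr_const card_ord sumrMnl.
  by apply: eq_bigr => v _; rewrite -E_mod modnMDl E_mod.
move/eqP: sum_all; rewrite !(bigD1 (Ordinal n_gt0) (P := xpredT)) //=.
rewrite [E 0%N]quot_gen0 mul0rn muln0 add0r.
rewrite [X in _ + X == _](eq_bigr (fun v : 'I_n => E v *+ d)) => [|v v0].
  by rewrite -[X in _ == X]add0r (inj_eq (addIr _)) => /eqP.
apply/esym; rewrite [LHS](quot_gen_rel n_gt0 t_rel) // modn_small // lt0n.
by apply: contra v0 => /eqP v0; apply/eqP/val_inj.
Qed.

(** * Reduction of the presentation from np to n *)

Section ReduceByPrime.
Variables (p n : nat) (o : seq nat) (i0 : nat).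
Hypotheses (p_pr : prime p) (n_gt0 : (0 < n)%N).
Hypotheses (o_uniq : uniq o) (o_lt : forall i, i \in o -> (i < p)%N) (o_i0 : i0 \in o).
Hypothesis o_0 : i0 = 0%N -> o = [:: 0%N].

Variables (A A' : zmodType) (E : nat -> A) (E' : nat -> A').
Hypotheses (presE : presentation (n * p) p o E) (presE' : presentation n p o E').

Let p_gt0 : (0 < p)%N. Proof. exact: prime_gt0. Qed.
Let np_gt0 : (0 < n * p)%N. Proof. by rewrite muln_gt0 n_gt0. Qed.

Lemma sum_offsets (B : zmodType) (F : nat -> B) :
  \sum_(i < p | val i \in o) F i = \sum_(i <- o) F i.
Proof.
rewrite -(big_mkord (mem o) F) /index_iota subn0.
rewrite -big_filter; apply: perm_big; apply: uniq_perm => //.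
  by rewrite filter_uniq ?iota_uniq.
move=> i; rewrite mem_filter mem_iota /= add0n.
by case oi: (i \in o); rewrite //= (o_lt oi).
Qed.

(** Let p c be the combination of relations with coefficients b. The relations of all u congruent to
    v modulo n involve the same block pv, ..., pv + p - 1; let B v be the sum of their b. At
    positive indices of this block, e = b - c satisfies p e = B v at offsets in [o] and e = 0
    elsewhere. The relations of level n then turn the sum of e E' into that of B v E'_v, which is
    the sum of b E'. *)
Lemma reduction_torsion (c : nat -> int) :
  (\sum_(v < n * p) E v *~ c v) *+ p = 0 -> \sum_(v < n * p) E' v *~ c v = 0.
Proof.
have -> : (\sum_(v < n * p) E v *~ c v) *+ p = \sum_(v < n * p) E v *~ (c v *+ p).
  by rewrite -sumrMnl; apply: eq_bigr => v _; rewrite pmulrn -mulrzA -mulr_natr natz.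
case/(pres_ker presE (c := fun v => c v *+ p)) => b cb.
pose B v0 := \sum_(u < p) b (u * n + v0)%N.
have tauE w : \sum_(v < n * p) \sum_(i <- o) b v *+ ((p * v + i) %% (n * p) == w)%N =
  \sum_(v < n) \sum_(i <- o) B v *+ (v * p + i == w)%N.
  pose F v := \sum_(i <- o) b v *+ ((p * v + i) %% (n * p) == w)%N.
  rewrite -(big_mkord xpredT F) mulnC big_mkord (sum_nat_blocks F) exchange_big /=.
  rewrite /F; apply: eq_bigr => v _.
  rewrite exchange_big /=; apply: eq_big_seq => i /o_lt i_lt.
  rewrite -sumrMnl; apply: eq_bigr => u _; congr (_ *+ (_ == _)).
  rewrite mulnDr mulnCA -addnA (mulnC p n) modnMDl modn_small ?(mulnC p) //.
  by rewrite -ltn_divLR // divnMDl // divn_small // addn0.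
pose e w := b w - c w.
have eE v i : (v < n)%N -> (i < p)%N -> (0 < v * p + i)%N ->
    e (v * p + i)%N *+ p = B v *+ (i \in o).
  move=> v_lt i_lt w_gt0; rewrite mulrnBl cb; last first.
    by rewrite w_gt0 -ltn_divLR // divnMDl // divn_small // addn0.
  rewrite tauE opprB addrC subrK (bigD1 (Ordinal v_lt)) //= [X in _ + X]big1 ?addr0; last first.
    move=> u; rewrite -val_eqE /= => uv; rewrite big1_seq // => j /andP[_ /o_lt j_lt].
    case: eqP => // /(congr1 (divn^~ p)); rewrite !divnMDl // !divn_small // !addn0.
    by move=> uv'; rewrite uv' eqxx in uv.
  rewrite (eq_bigr (fun j => B v *+ (j == i))) => [|j _]; last by rewrite eqn_add2l.
  have [oi|/negP oi] := boolP (i \in o).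
    rewrite (bigD1_seq i) //= eqxx big1 ?addr0 // => j /negPf->; exact: mulr0n.
  by rewrite big1_seq // => j /andP[_ oj]; case: eqP => // ij; case: oi; rewrite -ij.
have -> : \sum_(v < n * p) E' v *~ c v =
    \sum_(v < n * p) E' v *~ b v - \sum_(v < n * p) E' v *~ e v.
  by rewrite -sumrB; apply: eq_bigr => v _; rewrite -mulrzBr opprB addrC subrK.
apply/eqP; rewrite subr_eq0; apply/eqP.
rewrite -(big_mkord xpredT (fun v => E' v *~ b v)) mulnC big_mkord.
rewrite (sum_nat_blocks (fun v => E' v *~ b v)) mulnC.
rewrite (sum_nat_blocks (fun v => E' v *~ e v)) exchange_big /=.
apply: eq_bigr => v _.
rewrite (eq_bigr (fun i : 'I_p => E' v *~ b (i * n + v)%N)); last first.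
  by move=> i _; rewrite -(pres_mod presE') modnMDl (pres_mod presE').
rewrite -mulrz_sumr -/(B v).
have int_tf (x : int) : x *+ p = 0 -> x = 0.
  by move/eqP; rewrite mulrn_eq0 eqn0Ngt p_gt0 /= => /eqP.
rewrite [RHS](bigID (fun i : 'I_p => val i \in o)) /= [X in _ = _ + X]big1 => [|i oi].
  rewrite addr0 (sum_offsets (fun i => E' (v * p + i)%N *~ e (v * p + i)%N)).
  (* If all offsets of the block give index 0, nothing is known about e there, but then v = 0 and
     both sides vanish because E' 0 = 0. *)
  have [/hasP[i1 oi1 w_gt0]|/hasPn all0] := boolP (has (fun i => 0 < v * p + i)%N o).
    have Bv := eE v i1 (ltn_ord v) (o_lt oi1) w_gt0; rewrite oi1 mulr1n in Bv.
    transitivity (\sum_(i <- o) E' (v * p + i)%N *~ e (v * p + i1)%N).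
      by rewrite -mulrz_suml -Bv -mulr_natl natz mulrzA -pmulrn (pres_rel presE') mulnC.
    apply: eq_big_seq => i oi; have [->|wi_gt0] := posnP (v * p + i)%N.
      by rewrite (pres0 presE') !mul0rz.
    congr (_ *~ _); apply/eqP; rewrite -subr_eq0; apply/eqP/int_tf.
    rewrite mulrnBl (eE _ _ (ltn_ord v) (o_lt oi)) //.
    by rewrite (eE _ _ (ltn_ord v) (o_lt oi1)) // oi oi1 subrr.
  have v0 : v = 0%N :> nat.
    have := all0 _ o_i0; rewrite -eqn0Ngt addn_eq0 muln_eq0 [p == _]eqn0Ngt p_gt0 orbF.
    by case/andP=> /eqP.
  rewrite v0 (pres0 presE') mul0rz big1_seq // => i /andP[_ /all0].
  by rewrite v0 -eqn0Ngt => /eqP->; rewrite (pres0 presE') mul0rz.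
have [->|w_gt0] := posnP (v * p + i)%N; first by rewrite (pres0 presE') mul0rz.
have := eE _ _ (ltn_ord v) (ltn_ord i) w_gt0; rewrite (negPf oi) mulr0n.
by move/int_tf->; rewrite mulr0z.
Qed.

Lemma reduction_exists : exists r : {additive A -> A'},
  [/\ forall a', exists a, r a = a', forall a, r a = 0 -> a *+ p = 0
    & forall a, a *+ p = 0 -> r a = 0].
Proof.
have [|||r rE] := presentation_lift (g := E') np_gt0 presE; first exact: (pres0 presE').
- by move=> v; rewrite -(pres_mod presE') modn_dvdm ?dvdn_mulr // (pres_mod presE').
- exact: (pres_rel presE').
have rS c : r (\sum_(v < n * p) E v *~ c v) = \sum_(v < n * p) E' v *~ c v.
  by rewrite raddf_sum; apply: eq_bigr => v _; rewrite raddfMz rE.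
(* The map E'_v -> p E_v is well defined because p E_v, a sum of the E_(pv+i), depends only on v
   modulo n. Its composite with [r] is multiplication by p, so [r a = 0] forces p a = 0. *)
have [|||j jE] := presentation_lift (g := fun v => E v *+ p) n_gt0 presE'.
- by rewrite (pres0 presE) mul0rn.
- move=> v; rewrite !(pres_rel presE); apply: eq_bigr => i _.
  rewrite -[LHS](pres_mod presE) -[RHS](pres_mod presE).
  by rewrite muln_modr (mulnC n p) modnDml.
- by move=> v; rewrite {1}(pres_rel presE) sumrMnl.
exists r; split.
- move=> a'; have [c ->] := pres_gen presE' a'; exists (\sum_(v < n) E v *~ c v).
  by rewrite raddf_sum; apply: eq_bigr => v _; rewrite raddfMz rE.
- move=> a ra0; rewrite -[RHS](raddf0 j) -ra0; have [c ->] := pres_gen presE a.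
  rewrite !raddf_sum -sumrMnl; apply: eq_bigr => v _.
  by rewrite !raddfMz /= rE jE !pmulrn mulrzAC.
- by move=> a; have [c ->] := pres_gen presE a; rewrite rS; apply: reduction_torsion.
Qed.

(** Modulo p the relation of v says that the E_(pv+i) with i in [o] sum to 0, which eliminates the
    pivot E_(pv+i0). The generators indexed by [J] remain and form a basis of A/pA. *)
Let J := [set j : 'I_(n * p) | (j %% p != i0)%N && (j != 0 :> nat)%N].

Let pivot j := (j %/ p * p + i0)%N.

Let i0_lt : (i0 < p)%N. Proof. exact: o_lt. Qed.

Let pivotE v i : (i < p)%N -> pivot (v * p + i) = (v * p + i0)%N.
Proof. by move=> i_lt; rewrite /pivot divnMDl // divn_small // addn0. Qed.

Let block_lt v i : (v < n)%N -> (i < p)%N -> (v * p + i < n * p)%N.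
Proof. by move=> v_lt i_lt; rewrite -ltn_divLR // divnMDl // divn_small // addn0. Qed.

(** There are n pivots, and index 0 is excluded as well; it is already a pivot exactly when i0 =
    0. *)
Lemma card_nonpivots : #|J| = (n * p - n - (i0 != 0)%N)%N.
Proof.
pose f (v : 'I_n) : 'I_(n * p) := Ordinal (block_lt (ltn_ord v) i0_lt).
have f_inj : injective f.
  move=> u v /(congr1 val) /= /eqP; rewrite eqn_add2r eqn_pmul2r // => /eqP.
  exact: val_inj.
pose z : 'I_(n * p) := Ordinal np_gt0.
have -> : J = ~: (z |: f @: 'I_n).
  apply/setP=> j; rewrite !inE negb_or -val_eqE /= andbC; congr (_ && _).
  congr (~~ _); apply/eqP/imsetP => [ji0|[v _ ->] /=]; last first.
    by rewrite modnMDl modn_small.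
  have v_lt : (j %/ p < n)%N by rewrite ltn_divLR.
  by exists (Ordinal v_lt) => //; apply: val_inj; rewrite /= -ji0 -divn_eq.
rewrite cardsCs setCK card_ord cardsU1 card_imset // card_ord -subnDA addnC.
congr (_ - (_ + nat_of_bool (~~ _)))%N; apply/imsetP/eqP => [[v _]|i00].
  by move/(congr1 val)=> /= /esym/eqP; rewrite addn_eq0 => /andP[_ /eqP].
by exists (Ordinal n_gt0) => //; apply: val_inj; rewrite /= i00.
Qed.

Lemma sum_offsets_delta (R : pzRingType) v w :
  \sum_(i <- o) (v * p + i == w)%N%:R = ((v == w %/ p) && (w %% p \in o))%N%:R :> R.
Proof.
have div_eq i : (i < p)%N -> (v * p + i == w)%N = (v == w %/ p)%N && (i == w %% p)%N.
  move=> i_lt; apply/eqP/andP => [<-|[/eqP-> /eqP->]]; last by rewrite -divn_eq.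
  by rewrite divnMDl // divn_small // modnMDl modn_small // addn0.
rewrite (eq_big_seq (fun i => (v == w %/ p)%N%:R *+ (i == w %% p)%N)); last first.
  by move=> i /o_lt/div_eq->; case: (v == _)%N; rewrite //= mul0rn.
have [o_w|/negP o_w] := boolP (w %% p \in o)%N; last first.
  rewrite andbF big1_seq // => i /andP[_ oi]; case: (i =P _) => // iw.
  by case: o_w; rewrite -iw.
rewrite andbT (bigD1_seq (w %% p)%N) //= eqxx big1 ?addr0 // => i /negPf->.
exact: mulr0n.
Qed.

Lemma cotorsion_exists : exists k : {additive A -> 'rV['F_p]_#|J|},
  [/\ forall c, exists a, k a = c, forall a, k a = 0 -> exists b, a = b *+ p
    & forall b, k (b *+ p) = 0].
Proof.
(* Coordinate j of E_v: a pivot equals minus the sum of the other generators of its block at offsets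
   in [o]. *)
pose K (j : 'I_(n * p)) v : 'F_p :=
  (v %% (n * p) == j)%N%:R - (v %% (n * p) == pivot j)%N%:R *+ (j %% p \in o)%N.
have rowMp k (x : 'rV['F_p]_k) : x *+ p = 0.
  by apply/rowP=> i; rewrite mulmxnE mxE mulrn_pchar ?pchar_Fp.
have Fp_Mp (x : 'F_p) : x *+ p = 0 by rewrite mulrn_pchar // pchar_Fp.
have inJ (x : 'I_#|J|) : ((enum_val x %% p != i0) && (enum_val x != 0 :> nat))%N.
  by have := enum_valP x; rewrite inE.
have [|||k kE] := presentation_lift
  (g := fun v => \row_(x < #|J|) K (enum_val x) v) np_gt0 presE.
(* E_0 has to map to 0. If index 0 is a pivot, [o_0] guarantees that its block has no other offset
   in [o]. *)
- apply/rowP=> x; rewrite !mxE /K mod0n; have /andP[xp x0] := inJ x.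
  rewrite eq_sym (negPf x0) sub0r; apply/eqP; rewrite oppr_eq0.
  have [o_x|] := boolP (_ \in o); rewrite ?mulr0n // mulr1n.
  rewrite [(0 == _)%N]eq_sym /pivot addn_eq0; case: (i0 =P 0)%N => [i00|]; rewrite ?andbF //.
  by move: o_x xp; rewrite (o_0 i00) inE i00 => ->.
- by move=> v; apply/rowP=> x; rewrite !mxE /K modn_mod.
- move=> v; rewrite rowMp; apply/rowP=> x; rewrite mxE summxE.
  rewrite (eq_big_seq (fun i => (v %% n * p + i == enum_val x)%N%:R -
      (v %% n * p + i == pivot (enum_val x))%N%:R *+ (enum_val x %% p \in o)%N)).
    rewrite sumrB sumrMnl !sum_offsets_delta /pivot divnMDl // (divn_small i0_lt) addn0.
    rewrite modnMDl (modn_small i0_lt) o_i0 andbT.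
    by case: (_ \in o); rewrite ?andbT ?andbF ?mulr1n ?mulr0n subrr.
  move=> i /o_lt i_lt; rewrite mxE /K.
  suff -> : ((p * v + i) %% (n * p) = v %% n * p + i)%N by [].
  by rewrite (mulnC p) -modnDml -muln_modl modn_small // block_lt ?ltn_pmod.
have kS (c : nat -> int) x : k (\sum_(v < n * p) E v *~ c v) 0 x =
    (c (enum_val x))%:~R - (c (pivot (enum_val x)))%:~R *+ (enum_val x %% p \in o)%N.
  have delta w : (w < n * p)%N -> \sum_(v < n * p) (v == w :> nat)%:R *~ c v = (c w)%:~R :> 'F_p.
    move=> w_lt; rewrite (bigD1 (Ordinal w_lt)) //= eqxx big1 ?addr0 // => v.
    by rewrite -val_eqE /= => /negPf->; rewrite mul0rz.
  rewrite -delta // -(delta (pivot _)); last by rewrite block_lt // ltn_divLR.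
  rewrite raddf_sum summxE -sumrMnl -sumrB; apply: eq_bigr => v _.
  rewrite raddfMz kE -scaler_int !mxE /K modn_small // mulrzl mulrzBl.
  by case: (_ \in o); rewrite ?mulr1n ?mulr0n ?mul0rz.
exists k; split=> [y||b]; last by rewrite raddfMn rowMp.
- pose c v : int := \sum_(x < #|J|) (nat_of_ord (y 0 x))%:Z *+ (enum_val x == v :> nat).
  exists (\sum_(v < n * p) E v *~ c v); apply/rowP=> x; rewrite kS.
  rewrite /c (bigD1 x) //= eqxx mulr1n !big1 ?addr0 => [||z zx].
  - by rewrite mul0rn subr0 -[RHS]natr_Zp.
  - move=> z _; case: eqP => // zx; have /andP[] := inJ z.
    by rewrite zx /pivot modnMDl modn_small // eqxx.
  - by rewrite val_eqE (inj_eq enum_val_inj) (negPf zx).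
move=> a; have [c ->] := pres_gen presE a => ka0.
(* Subtracting the pivot coefficient leaves multiples of p, with quotients [q]; the subtracted part
   of block v is c_pivot times a relation, that is, p c_pivot E_v. *)
pose q w := ((c w - c (pivot w) *+ (w %% p \in o)%N) %/ p)%Z.
exists (\sum_(v < n) (E v *~ c (v * p + i0)%N +
   \sum_(i < p) E (v * p + i)%N *~ q (v * p + i)%N)).
rewrite (sum_nat_blocks (fun w => E w *~ c w)) -sumrMnl; apply: eq_bigr => v _.
rewrite mulrnDl; have -> : E v *~ c (v * p + i0)%N *+ p =
    \sum_(i < p) E (v * p + i)%N *~ (c (v * p + i0)%N *+ (val i \in o)).
  rewrite [RHS](bigID (fun i : 'I_p => val i \in o)) /= [X in _ = _ + X]big1 ?addr0; last first.
    by move=> i /negPf->; rewrite mulr0z.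
  rewrite (eq_bigr (fun i : 'I_p => E (v * p + i)%N *~ c (v * p + i0)%N)); last first.
    by move=> i ->.
  rewrite (sum_offsets (fun i => E (v * p + i)%N *~ c (v * p + i0)%N)) -mulrz_suml mulnC.
  by rewrite -(pres_rel presE) !pmulrn mulrzAC.
rewrite -sumrMnl -big_split /=; apply: eq_bigr => i _.
set w := (v * p + i)%N; have [->|w_gt0] := posnP w.
  by rewrite (pres0 presE) !mul0rz mul0rn addr0.
have w_p : (w %% p = i)%N by rewrite modnMDl modn_small.
have w_piv : pivot w = (v * p + i0)%N by rewrite pivotE.
rewrite [X in _ = _ + X]pmulrn -mulrzA -mulrzDr; congr (_ *~ _); rewrite /q w_p w_piv.
set u := c (v * p + i0)%N *+ _.
suff dvd_p : c w - u \in dvdz p%:Z by rewrite (divzK dvd_p) addrC subrK.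
have [ii0|ii0] := eqVneq (val i) i0.
  by rewrite /u /w ii0 o_i0 mulr1n subrr dvdz0.
have w_lt : (w < n * p)%N by rewrite block_lt.
have wJ : Ordinal w_lt \in J by rewrite inE /= w_p ii0 -lt0n.
have := kS c (enum_rank_in wJ (Ordinal w_lt)); rewrite ka0 mxE enum_rankK_in //= w_p w_piv.
have p_Fp : p \in [pchar 'F_p] by rewrite pchar_Fp.
by rewrite (dvdz_pcharf p_Fp) rmorphB rmorphMn /= => <-.
Qed.

End ReduceByPrime.

(** * Character duality *)

(** Smith normal form: in the coordinates c R^-1 the row lattice is a product of ideals [D i], with
    [D i = 0] for columns beyond the number of rows. *)
Lemma row_span_elementary_divisors m n (M : 'M[int]_(m, n)) :
  exists2 R : 'M[int]_n, R \in unitmx & exists D : 'I_n -> int, forall c : 'rV[int]_n,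
    (exists b, c = b *m M) <-> (forall i, (c *m invmx R) 0 i \in dvdz (D i)).
Proof.
have [L uL [R uR [s _ ->]]] := int_Smith_normal_form M.
exists R => //; exists (fun i => if (i < m)%N then s`_i else 0) => c; split.
  case=> b ->; rewrite !mulmxA mulmxK // => i; rewrite mxE.
  apply: (big_ind (fun x => x \in dvdz _)) => [|x y dx dy|k _]; first exact: dvdz0.
    exact: rpredD.
  by rewrite [X in _ * X]mxE; case: eqP => [<-|_]; rewrite ?ltn_ord ?mulr0 ?dvdz0 // dvdz_mull.
move=> Dc; pose y (i : 'I_n) := divz ((c *m invmx R) 0 i) (if (i < m)%N then s`_i else 0).
pose b : 'rV[int]_m := \row_k if insub (val k) is Some i then y i else 0.
exists (b *m invmx L); rewrite -!mulmxA [invmx L *m _]mulmxA mulVmx // mul1mx.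
rewrite mulmxA -[LHS](mulmxKV uR); congr (_ *m _); apply/rowP=> i.
rewrite -[LHS](divzK (Dc i)) -/(y i) mxE; case: ifP => [i_m|im]; last first.
  rewrite mulr0 big1 // => k _; rewrite !mxE; case: eqP => [ki|_]; rewrite ?mulr0 //.
  by rewrite -ki ltn_ord in im.
rewrite (bigD1 (Ordinal i_m)) //= !mxE /= eqxx valK big1 ?addr0 // => k.
by rewrite -val_eqE /= => /negPf ki; rewrite !mxE ki mulr0.
Qed.

Lemma exprz_prim_root_eq1 (K : fieldType) N (z : K) (x : int) :
  (0 < N)%N -> N.-primitive_root z -> (z ^ x == 1) = (N%:Z %| x)%Z.
Proof.
move=> N_gt0 pz; have z0 : z != 0 by rewrite (prim_root_eq0 pz) -lt0n.
case: x => k; first by rewrite -exprnP -(prim_order_dvd pz) dvdzE.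
by rewrite NegzE -invr_expz invr_eq1 -exprnP -(prim_order_dvd pz) dvdzE /=.
Qed.

Section Duality.
Variables (n d : nat) (o : seq nat) (n_gt0 : (0 < n)%N).
Variables (A : zmodType) (E : nat -> A).
Hypothesis presE : presentation n d o E.
Variables (K : fieldType) (N : nat) (z : K).
Hypotheses (N_gt0 : (0 < N)%N) (prim_z : N.-primitive_root z).
Hypothesis A_N : forall a : A, a *+ N = 0.

Local Notation ix v := (Ordinal (ltn_pmod v n_gt0)).

Let relM : 'M[int]_n :=
  \matrix_(v, w) ((v == w)%:R *+ d - \sum_(i <- o) ((d * v + i) %% n == w)%N%:R).
Let M : 'M[int]_(1 + n, n) := col_mx (\row_w (w == 0 :> nat)%N%:R) relM.
Let cls (c : 'rV[int]_n) : A := \sum_(v < n) E v *~ c 0 v.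

Let cls_zmod : zmod_morphism cls.
Proof.
by move=> x y; rewrite -sumrB; apply: eq_bigr => v _; rewrite !mxE mulrzDr mulrNz.
Qed.
HB.instance Definition _ := GRing.isZmodMorphism.Build _ _ cls cls_zmod.

Let mul_relM (b : 'rV[int]_n) w : (b *m relM) 0 w =
  b 0 w *+ d - \sum_(v < n) \sum_(i <- o) b 0 v *+ ((d * v + i) %% n == w)%N.
Proof.
rewrite mxE (eq_bigr (fun v : 'I_n => b 0 v *+ (v == w) *+ d -
    \sum_(i <- o) b 0 v *+ ((d * v + i) %% n == w)%N)).
  rewrite sumrB; congr (_ - _); rewrite (bigD1 w) //= eqxx big1 ?addr0 // => v /negPf->.
  by rewrite mul0rn.
move=> v _; rewrite mxE mulrBr mulrnAr mulr_natr; congr (_ - _).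
by rewrite mulr_sumr; apply: eq_bigr => i _; rewrite mulr_natr.
Qed.

Let cls_eq0 c : cls c = 0 <-> exists b, c = b *m M.
Proof.
split=> [cls0|[b ->]].
  pose c' v := c 0 (ix v).
  have ixE (v : 'I_n) : ix v = v by apply: val_inj; rewrite /= modn_small.
  have [|b' cb] := pres_ker presE (c := c').
    by rewrite -[RHS]cls0; apply: eq_bigr => v _; rewrite /c' ixE.
  pose b : 'rV[int]_n := \row_v b' v.
  exists (row_mx ((c - b *m relM) 0 (ix 0%N))%:M b); rewrite mul_row_col.
  apply/rowP=> w.
  rewrite [RHS]mxE mul_scalar_mx [X in _ = X + _]mxE [X in _ = _ * X + _]mxE.
  have [w0|w_gt0] := posnP w.
    have -> : ix 0%N = w by apply: val_inj; rewrite /= w0 mod0n.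
    by rewrite mulr1 [X in X + _]mxE [X in _ + X + _]mxE subrK.
  rewrite mulr0 add0r mul_relM.
  have := cb w; rewrite w_gt0 ltn_ord /c' ixE => ->//; rewrite mxE; congr (_ - _).
  by apply: eq_bigr => v _; rewrite mxE.
rewrite -[b]hsubmxK mul_row_col; set b2 := rsubmx b.
pose cM := lsubmx b *m \row_w (w == 0 :> nat)%:R + b2 *m relM.
have cE (w : 'I_n) : cM 0 w = cM 0 (ix w) by congr (cM 0 _); apply: val_inj; rewrite /= modn_small.
rewrite -[LHS]/(cls cM) /cls (eq_bigr (fun v : 'I_n => E v *~ cM 0 (ix v))) => [|v _]; last first.
  by rewrite -cE.
pose b3 v := b2 0 (ix v).
apply: (sum_relations0 (c := fun v => cM 0 (ix v)) (b := b3) n_gt0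
  (pres0 presE) (pres_mod presE) (pres_rel presE)) => w.
case/andP=> w_gt0 w_lt; rewrite /cM mxE mul_relM mxE big1 ?add0r => [|k _]; last first.
  by rewrite !mxE /= modn_small // eqn0Ngt w_gt0 mulr0.
rewrite /b3; congr (_ - _); apply: eq_bigr => v _; apply: eq_bigr => i _.
rewrite /= (modn_small w_lt); congr (b2 0 _ *+ _); apply: val_inj.
by rewrite /= modn_small.
Qed.

(** [D a] is the character z^(a, -) for a perfect symmetric pairing of A with itself modulo N. [D]
    is therefore an isomorphism onto the characters with values in the powers of z. *)
Lemma presentation_dual : exists D : A -> nat -> K,
  [/\ [/\ forall a v, D a (v %% n)%N = D a v, forall a, D a 0%N = 1,
          forall a v, D a v ^+ d = \prod_(i <- o) D a (d * v + i)%N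
        & forall a v, D a v != 0],
      forall a b v, D (a + b) v = D a v * D b v,
      forall a, (forall v, D a v = 1) -> a = 0
    & forall y : nat -> K, (forall v, exists k : nat, y v = z ^+ k) ->
        (forall v, y (v %% n)%N = y v) -> y 0%N = 1 ->
        (forall v, y v ^+ d = \prod_(i <- o) y (d * v + i)%N) ->
      exists a, forall v, D a v = y v].
Proof.
have [R uR [D latP]] := row_span_elementary_divisors M.
have clsP c : cls c = 0 <-> forall i, (c *m invmx R) 0 i \in dvdz (D i).
  by rewrite cls_eq0.
have z0 : z != 0 by rewrite (prim_root_eq0 prim_z) -lt0n.
have z1 x : (z ^ x == 1) = (N%:Z %| x)%Z by apply: exprz_prim_root_eq1.
have D_N i : (D i %| N%:Z)%Z.
  have /clsP/(_ i) : cls (row i R *+ N) = 0 by rewrite raddfMn A_N.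
  by rewrite -scaler_nat -scalemxAl -row_mul mulmxV // !mxE eqxx mulr1 natz.
pose e i := (N%:Z %/ D i)%Z.
have eD i : e i * D i = N%:Z by apply: divzK.
have e0 i : e i != 0.
  by apply: contraTneq N_gt0 => ei; have := eD i; rewrite ei mul0r => -[<-].
have D0 i : D i != 0.
  by apply: contraTneq N_gt0 => Di; have := eD i; rewrite Di mulr0 => -[<-].
(* With e_i D_i = N, the integral form c W c'^T is divisible by N as soon as c or c' is a relation,
   so it descends to A. *)
pose W := invmx R *m diag_mx (\row_i e i) *m (invmx R)^T.
have trW : W^T = W by rewrite /W !trmx_mul trmxK tr_diag_mx mulmxA.
have wt_lat c : cls c = 0 -> forall v, (c *m W) 0 v \in dvdz N%:Z.
  move/clsP=> Dc v; rewrite /W !mulmxA mxE; apply: rpred_sum => i _.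
  rewrite mul_mx_diag !mxE; have := Dc i; rewrite mxE => /dvdzP[x ->].
  by apply/dvdzP; exists (x * invmx R v i); rewrite -(eD i); ring.
have dual c (x : 'rV[int]_n) : cls c = 0 -> (c *m (x *m W)^T) 0 0 \in dvdz N%:Z.
  move=> cls0; rewrite trmx_mul trW mulmxA mxE; apply: rpred_sum => v _.
  by rewrite dvdz_mulr // wt_lat.
pose Y (k : 'rV[int]_n) v := z ^ k 0 (ix v).
have ixE (v : 'I_n) : ix v = v by apply: val_inj; rewrite /= modn_small.
have zS (I : Type) (r : seq I) (F : I -> int) : z ^ (\sum_(i <- r) F i) = \prod_(i <- r) z ^ F i.
  by apply: (big_morph (exprz z)) => // x y; rewrite expfzDr.
have zXn x k : z ^ (x *+ k) = (z ^ x) ^+ k.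
  by rewrite exprnP exprz_exp -mulr_natr natz.
have relY k (v : 'I_n) : ((relM *m k^T) v 0 \in dvdz N%:Z) =
    (Y k v ^+ d == \prod_(i <- o) Y k (d * v + i)%N).
  have -> : (relM *m k^T) v 0 = k 0 (ix v) *+ d - \sum_(i <- o) k 0 (ix (d * v + i)%N).
    rewrite mxE (eq_bigr (fun w : 'I_n => k 0 w *+ (v == w) *+ d -
      \sum_(i <- o) k 0 w *+ ((d * v + i) %% n == w)%N)); last first.
      move=> w _; rewrite !mxE mulrBl mulrnAl mulr_natl mulr_suml; congr (_ - _).
      by apply: eq_bigr => i _; rewrite mulr_natl.
    rewrite sumrB exchange_big /=; congr (_ - _).
      rewrite (bigD1 v) //= eqxx ixE big1 ?addr0 // => w.
      by rewrite eq_sym => /negPf->; rewrite mul0rn.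
    apply: eq_bigr => i _; rewrite (bigD1 (ix (d * v + i)%N)) //= eqxx big1 ?addr0 // => w.
    by rewrite -val_eqE /= eq_sym => /negPf->.
  rewrite -z1 expfzDr // -invr_expz zXn zS -subr_eq0.
  have P0 : \prod_(i <- o) Y k (d * v + i)%N != 0.
    by rewrite prodf_seq_neq0; apply/allP => i _; apply: expfz_neq0.
  by rewrite -(inj_eq (mulIf P0)) mulrBl mulfVK // mul1r mul0r subr_eq0.
have row0E (k : 'rV[int]_n) : (\row_w (w == 0 :> nat)%:R *m k^T) 0 0 = k 0 (ix 0%N).
  rewrite mxE (bigD1 (ix 0%N)) //= !mxE /=.
  have -> : (0 %% n == 0)%N by rewrite mod0n.
  rewrite mul1r big1 ?addr0 // => w.
  by rewrite -val_eqE /= mod0n => /negPf w0; rewrite !mxE w0 mul0r.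
have Y_mod k v : Y k (v %% n)%N = Y k v.
  by congr (z ^ k 0 _); apply: val_inj; rewrite /= modn_mod.
have Y_rel k : (forall v : 'I_n, Y k v ^+ d = \prod_(i <- o) Y k (d * v + i)%N) ->
    forall v, Y k v ^+ d = \prod_(i <- o) Y k (d * v + i)%N.
  move=> Yk v; have := Yk (ix v); rewrite Y_mod => ->; apply: eq_bigr => i _.
  by rewrite -[LHS]Y_mod -[RHS]Y_mod /= -modnDml modnMmr modnDml.
have co_ex (a : A) : exists c : 'rV[int]_n, cls c == a.
  have [c ->] := pres_gen presE a; exists (\row_v c v).
  by apply/eqP/eq_bigr => v _; rewrite mxE.
pose co a := xchoose (co_ex a).
have clsK a : cls (co a) = a by apply/eqP; apply: (xchooseP (co_ex a)).
have Y_ext c c' v : cls c = cls c' -> Y (c *m W) v = Y (c' *m W) v.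
  move=> cc'; have : cls (c - c') = 0 by rewrite raddfB /= cc' subrr.
  move/wt_lat/(_ (ix v)); rewrite -z1 mulmxBl [X in z ^ X]mxE [X in z ^ (_ + X)]mxE.
  rewrite expfzDr // -invr_expz => /eqP zz.
  by rewrite -[RHS]mul1r -zz divfK // expfz_neq0.
exists (fun a => Y (co a *m W)); split=> [|a b v|a Da|y yz y_mod y0 y_rel].
- split=> // [a|a|a v]; last exact: expfz_neq0.
    apply/eqP; rewrite z1 -row0E dual //; apply/cls_eq0.
    by exists (row_mx 1%:M 0); rewrite mul_row_col mul1mx mul0mx addr0.
  apply: Y_rel => v; apply/eqP; rewrite -relY.
  have := dual (row v relM) (co a); rewrite -row_mul mxE; apply; apply/cls_eq0.
  by exists (row_mx 0 (delta_mx 0 v)); rewrite mul_row_col mul0mx add0r -rowE.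
- rewrite (Y_ext _ (co a + co b)); last by rewrite raddfD /= !clsK.
  by rewrite /Y mulmxDl [X in z ^ X]mxE expfzDr.
- rewrite -[a]clsK; apply/clsP => i.
  have : (co a *m W *m R^T) 0 i \in dvdz N%:Z.
    rewrite mxE; apply: rpred_sum => v _; rewrite dvdz_mulr //.
    by rewrite -z1 -[v]ixE -/(Y _ v) Da.
  rewrite /W !mulmxA -mulmxA -trmx_mul mulmxV // trmx1 mulmx1 mul_mx_diag [X in X \in _]mxE.
  by rewrite [X in _ * X]mxE -(eD i) [e i * _]mulrC dvdz_mul2r.
have yz' v : exists k, y v == z ^+ k by have [k /eqP] := yz v; exists k.
pose k : 'rV[int]_n := \row_v (xchoose (yz' v))%:Z.
have Yk v : Y k v = y v.
  by rewrite /Y mxE -exprnP /= -(eqP (xchooseP (yz' _))) y_mod.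
have Mk v : (M *m k^T) v 0 \in dvdz N%:Z.
  rewrite mul_col_mx -[v]splitK; case: (fintype.split v) => u /=.
    by rewrite col_mxEu (ord1 u) row0E -z1 -/(Y k 0%N) Yk y0.
  rewrite col_mxEd relY Yk y_rel; apply/eqP/eq_bigr => i _; exact/esym/Yk.
have lat_k c : cls c = 0 -> (c *m k^T) 0 0 \in dvdz N%:Z.
  case/cls_eq0=> b ->; rewrite -mulmxA mxE; apply: rpred_sum => v _.
  by rewrite dvdz_mull // Mk.
(* D_i times row i of R is a relation, so N = D_i e_i divides D_i (R k^T)_i. The quotients by e_i
   are then integral, and they solve x R W = k. *)
have e_dvd i : (R *m k^T) i 0 \in dvdz (e i).
  have /lat_k : cls (D i *: row i R) = 0.
    apply/clsP => j; rewrite -scalemxAl -row_mul mulmxV // !mxE.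
    by case: eqP => [->|_]; rewrite ?mulr1 ?mulr0 ?dvdz0 ?dvdzz.
  rewrite -scalemxAl -row_mul mxE [X in _ * X]mxE -(eD i) [D i * _]mulrC.
  by rewrite dvdz_mul2r.
pose x : 'rV[int]_n := \row_i divz ((R *m k^T) i 0) (e i).
have xk : x *m R *m W = k.
  rewrite /W !mulmxA mulmxK // -[RHS]mulmx1 -trmx1 -(mulVmx uR) trmx_mul mulmxA.
  congr (_ *m _); apply/rowP=> i; rewrite mul_mx_diag mxE [x _ _]mxE [X in _ * X]mxE.
  by rewrite divzK ?e_dvd // -[R *m k^T]trmxK trmx_mul trmxK mxE.
by exists (cls (x *m R)) => v; rewrite (Y_ext _ (x *m R)) ?clsK // xk Yk.
Qed.

End Duality.

(** * Circulant matrices as polynomials *)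

Section CirculantPoly.
Variables (F : finFieldType) (n : nat).
Hypothesis n_gt0 : (0 < n)%N.
Local Notation X := (circ_X F n).
Local Notation N := n.-1.+1.
Local Notation Xn1 := ('X^n - 1 : {poly F}).

Let N_n : N = n. Proof. exact: prednK. Qed.

Lemma circ_X_exp k (i j : 'I_N) : (X ^+ k) i j = (i == (j + k) %% N :> nat)%N%:R.
Proof.
elim: k i j => [|k IHk] i j; first by rewrite expr0 addn0 mxE modn_small.
rewrite exprS mxE; have l_lt : ((j + k) %% N < N)%N by rewrite ltn_pmod.
rewrite (bigD1 (Ordinal l_lt)) //= IHk /= eqxx mulr1 mxE big1 ?addr0; last first.
  by move=> l; rewrite -val_eqE /= IHk => /negPf->; rewrite mulr0.
by rewrite -val_eqE /=; congr ((_ == _)%:R); rewrite -addn1 modnDml addn1 addnS.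
Qed.

Lemma horner_circ_X0 (p : {poly F}) (i : 'I_N) :
  (size p <= n)%N -> horner_mx X p i 0 = p`_i.
Proof.
move=> size_p.
have {1}-> : p = \sum_(k < N) p`_k *: 'X^k.
  rewrite -poly_def; apply/polyP=> k; rewrite coef_poly N_n; case: ltnP => // nk.
  by rewrite nth_default // (leq_trans size_p).
rewrite linear_sum summxE (bigD1 i) //= linearZ rmorphXn /= horner_mx_X mxE circ_X_exp.
rewrite add0n modn_small // eqxx mulr1 big1 ?addr0 // => k ki.
rewrite linearZ rmorphXn /= horner_mx_X mxE circ_X_exp add0n modn_small // val_eqE.
by rewrite eq_sym (negPf ki) mulr0.
Qed.

Lemma circ_X_expn : X ^+ n = 1.
Proof.
apply/matrixP=> i j; rewrite circ_X_exp mxE -val_eqE /=.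
by rewrite -[X in (j + X)%N]N_n modnDr modn_small.
Qed.

Lemma size_Xn1 : size Xn1 = n.+1. Proof. exact: size_XnsubC. Qed.

Lemma Xn1_neq0 : Xn1 != 0. Proof. by rewrite -size_poly_eq0 size_Xn1. Qed.

Lemma horner_circ_X_Xn1 : horner_mx X Xn1 = 0.
Proof. by rewrite rmorphB rmorphXn rmorph1 /= horner_mx_X circ_X_expn subrr. Qed.

(** Column 0 of p(X) lists the coefficients of p when deg p < n, so F[X] is exactly F[x]/(x^n -
    1). *)
Lemma horner_circ_X_eq0 p : (horner_mx X p == 0) = (Xn1 %| p).
Proof.
rewrite /dvdp {1}(divp_eq p Xn1) rmorphD rmorphM /= horner_circ_X_Xn1 mulr0 add0r.
set r := p %% Xn1; have size_r : (size r <= n)%N.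
  by rewrite -ltnS -size_Xn1 ltn_modp Xn1_neq0.
apply/eqP/eqP => [hr0|->]; last by rewrite rmorph0.
apply/polyP=> i; rewrite coef0; have [i_lt|n_i] := ltnP i n; last first.
  by rewrite nth_default // (leq_trans size_r).
have i_N : (i < N)%N by rewrite N_n.
by rewrite -(horner_circ_X0 (Ordinal i_N) size_r) hr0 mxE.
Qed.

Lemma horner_circ_X_eq p q : (horner_mx X p == horner_mx X q) = (Xn1 %| p - q).
Proof. by rewrite -subr_eq0 -rmorphB horner_circ_X_eq0. Qed.

(** X fixes the all-ones vector. Membership in C'(n,q) thus becomes p(1) = 1. *)
Lemma mul_circ_X_ones p :
  horner_mx X p *m const_mx 1 = const_mx p.[1] :> 'cV[F]_N.
Proof.
have X1 : X *m const_mx 1 = const_mx 1 :> 'cV[F]_N.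
  by have := circ_gen_units1 F n; rewrite inE => /andP[_ /eqP].
elim/poly_ind: p => [|p c IHp].
  by rewrite rmorph0 mul0mx horner0; apply/matrixP=> i j; rewrite !mxE.
rewrite rmorphD rmorphM /= horner_mx_X horner_mx_C mulmxDl -mulmxA X1 IHp.
by apply/matrixP=> i j; rewrite mul_scalar_mx !mxE hornerMXaddC !mulr1.
Qed.

(** Meaningful when p is coprime to X^n - 1; otherwise [insubd] returns the default 1. *)
Definition circ_poly (p : {poly F}) : {'GL_n[F]} :=
  insubd (1%g : {'GL_n[F]}) (horner_mx X p).

Lemma coprime_circ_unit p : coprimep p Xn1 -> horner_mx X p \is a GRing.unit.
Proof.
case/Bezout_eq1_coprimepP=> -[u v] /= uv1.
have up1 : horner_mx X u *m horner_mx X p = 1%:M.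
  have := congr1 (horner_mx X) uv1.
  by rewrite rmorphD !rmorphM rmorph1 /= horner_circ_X_Xn1 mulr0 addr0.
by have [_] := mulmx1_unit up1.
Qed.

Lemma circ_polyE p : coprimep p Xn1 -> GLval (circ_poly p) = horner_mx X p.
Proof.
move=> /coprime_circ_unit up.
have -> : GLval (circ_poly p) = val (circ_poly p) by case: (circ_poly p).
by rewrite insubdK.
Qed.

Lemma GLval_inj (g h : {'GL_n[F]}) : GLval g = GLval h -> g = h.
Proof. by case: g h => [A uA] [B uB] /= AB; apply: val_inj. Qed.

Lemma circ_poly_eq p q : coprimep p Xn1 -> coprimep q Xn1 ->
  (circ_poly p == circ_poly q) = (Xn1 %| p - q).
Proof.
by move=> cop coq; rewrite -horner_circ_X_eq -!circ_polyE.
Qed.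

Lemma circ_polyM p q : coprimep p Xn1 -> coprimep q Xn1 ->
  circ_poly (p * q) = (circ_poly p * circ_poly q)%g.
Proof.
move=> cop coq; apply: GLval_inj.
by rewrite GL_ME !circ_polyE ?coprimepMl ?cop // rmorphM.
Qed.

Lemma circ_poly1 : circ_poly 1 = 1%g.
Proof. by apply: GLval_inj; rewrite circ_polyE ?coprime1p // rmorph1 GL_1E. Qed.

Lemma circ_polyX p k : coprimep p Xn1 -> circ_poly (p ^+ k) = (circ_poly p ^+ k)%g.
Proof.
move=> cop; elim: k => [|k IHk]; first by rewrite expr0 circ_poly1 expg0.
by rewrite exprS expgS circ_polyM ?IHk // coprimep_expl.
Qed.

Lemma coprimeX_Xn1 : coprimep 'X Xn1.
Proof.
rewrite coprimep_sym -[X in coprimep _ X]subr0 -(rmorph0 polyC) coprimep_XsubC /root !hornerE /=.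
by rewrite expr0n eqn0Ngt n_gt0 sub0r oppr_eq0 oner_eq0.
Qed.

Lemma circ_poly_gen : circ_poly 'X = circ_gen F n.
Proof.
by apply: GLval_inj; rewrite circ_polyE ?coprimeX_Xn1 //= horner_mx_X.
Qed.

Lemma circ_poly_genX k : circ_poly 'X^k = (circ_gen F n ^+ k)%g.
Proof. by rewrite circ_polyX ?coprimeX_Xn1 // circ_poly_gen. Qed.

Lemma circ_poly_units1 p : coprimep p Xn1 -> p.[1] = 1 ->
  circ_poly p \in circ_units1 F n.
Proof.
move=> cop p1; rewrite inE [X in X *m _]circ_polyE // mul_circ_X_ones p1 eqxx andbT.
rewrite inE; apply/andP; split.
  by rewrite circ_polyE //; apply/circulantP; exists p.
(* The Bezout cofactor of p represents the inverse, which is therefore a polynomial in X too. *)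
have /Bezout_eq1_coprimepP[[u v] /= uv1] := cop.
have cou : coprimep u Xn1.
  by apply/Bezout_eq1_coprimepP; exists (p, v); rewrite /= [p * u]mulrC.
suff: GLval (circ_poly p)^-1%g \in @circulant F n by [].
have -> : (circ_poly p)^-1%g = circ_poly u.
  apply/eqP; rewrite eq_invg_mul -circ_polyM // -circ_poly1.
  rewrite circ_poly_eq ?coprimepMl ?cop ?coprime1p //.
  by rewrite [p * u]mulrC (canRL (addrK _) uv1) addrAC subrr sub0r dvdpNr dvdp_mull.
by rewrite circ_polyE //; apply/circulantP; exists u.
Qed.

Definition poly_circ (g : {'GL_n[F]}) : {poly F} := \poly_(i < n) GLval g (inord i) 0.

Lemma poly_circP g : g \in circ_units1 F n ->
  [/\ coprimep (poly_circ g) Xn1, (poly_circ g).[1] = 1 & circ_poly (poly_circ g) = g].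
Proof.
rewrite !inE => /andP[/andP[/existsP[c /eqP g_c] /circulantP[q gV_q]] /eqP g1].
set p := rVpoly c in g_c; have size_p : (size p <= n)%N by rewrite -[X in (_ <= X)%N]N_n size_poly.
have -> : poly_circ g = p.
  apply/polyP=> i; rewrite coef_poly; case: ltnP => [i_lt|n_i]; last first.
    by rewrite nth_default // (leq_trans size_p).
  by rewrite g_c horner_circ_X0 // inordK ?N_n.
have cop : coprimep p Xn1.
  have : horner_mx X (p * q) == horner_mx X 1.
    by rewrite rmorphM rmorph1 /= -g_c -gV_q -GL_ME mulgV GL_1E.
  rewrite horner_circ_X_eq => /dvdpP[v pq].
  apply/Bezout_eq1_coprimepP; exists (q, - v); rewrite /= mulNr -pq.
  by rewrite mulrC opprB addrC subrK.
split=> //; last by apply: GLval_inj; rewrite circ_polyE.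
by have := g1; rewrite g_c mul_circ_X_ones => /matrixP/(_ 0 0); rewrite !mxE.
Qed.

Lemma circ_gen_order : #[circ_gen F n]%g = n.
Proof.
apply/eqP; rewrite eqn_dvd order_dvdn -circ_poly_genX -circ_poly1.
rewrite circ_poly_eq ?coprimep_expl ?coprimeX_Xn1 ?coprime1p // dvdpp /=.
set k := #[_]%g; have k_gt0 : (0 < k)%N := order_gt0 _.
have : circ_poly 'X^k == circ_poly 1 by rewrite circ_poly_genX expg_order circ_poly1.
rewrite circ_poly_eq ?coprimep_expl ?coprimeX_Xn1 ?coprime1p //.
rewrite -horner_circ_X_eq0 rmorphB rmorphXn rmorph1 /= horner_mx_X => /eqP/matrixP/(_ 0 0).
rewrite [LHS]mxE circ_X_exp !mxE add0n /= N_n /dvdn.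
by case: (0 =P k %% n)%N => [<-|_] //; rewrite add0r => /eqP; rewrite oppr_eq0 oner_eq0.
Qed.

End CirculantPoly.

(** * Evaluation at roots of unity *)

Lemma pchar_nat_card (F : finFieldType) p : p \in [pchar F] -> p.-nat #|F|.
Proof.
move=> charFp; have /abelem_pgroup := fin_ring_pchar_abelem charFp.
by rewrite /pgroup cardsT.
Qed.

Lemma pchar_dvd_card (F : finFieldType) p : p \in [pchar F] -> (p %| #|F|)%N.
Proof.
move=> charFp; rewrite (dvdn_pcharf charFp) -cardsT.
exact/eqP/(expg_cardG (in_setT (1 : F))).
Qed.

Lemma natr_card_neq0 (F : finFieldType) n : coprime n #|F| -> n%:R != 0 :> F.
Proof.
have [p p_pr charFp] := finPcharP F => co_nq.
rewrite -(dvdn_pcharf charFp); apply/negP=> pn.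
have := dvdn_gcd p n #|F|; rewrite (eqP co_nq) pn pchar_dvd_card // dvdn1 => /eqP p1.
by rewrite p1 in p_pr.
Qed.

Section Evaluation.
Variables (F : finFieldType) (n : nat) (n_gt0 : (0 < n)%N).
Variables (K : finFieldType) (emb : {rmorphism F -> K}) (zeta : K).
Local Notation q := #|F|.
Hypothesis prim_zeta : n.-primitive_root zeta.
Hypothesis fixK : forall y : K, y ^+ q = y -> exists x, y = emb x.
Hypothesis co_nq : coprime n q.
Local Notation Xn1 := ('X^n - 1 : {poly F}).
Local Notation C1 := (circ_units1 F n).

(** The discrete Fourier transform of the first column of g. *)
Definition circ_ev (g : {'GL_n[F]}) v : K :=
  (map_poly emb (poly_circ g)).[zeta ^+ v].

Let zeta_n v : (zeta ^+ v) ^+ n = 1.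
Proof. by rewrite exprAC (prim_expr_order prim_zeta) expr1n. Qed.

Lemma horner_map_mod (p p' : {poly F}) v : Xn1 %| p - p' ->
  (map_poly emb p).[zeta ^+ v] = (map_poly emb p').[zeta ^+ v].
Proof.
case/dvdpP=> u /(canRL (subrK _)) ->.
rewrite rmorphD rmorphM rmorphB rmorph1 rmorphXn /= map_polyX !hornerE.
by rewrite zeta_n subrr mulr0 add0r.
Qed.

Lemma circ_ev_poly p v : coprimep p Xn1 -> p.[1] = 1 ->
  circ_ev (circ_poly n p) v = (map_poly emb p).[zeta ^+ v].
Proof.
move=> cop p1; apply: horner_map_mod.
have [cog _ gE] := poly_circP n_gt0 (circ_poly_units1 n_gt0 cop p1).
by rewrite -circ_poly_eq // gE.
Qed.

Lemma circ_evM g h v : g \in C1 -> h \in C1 ->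
  circ_ev (g * h)%g v = circ_ev g v * circ_ev h v.
Proof.
move=> /(poly_circP n_gt0)[cog g1 gE] /(poly_circP n_gt0)[coh h1 hE].
rewrite -{1}gE -{1}hE -circ_polyM // circ_ev_poly ?coprimepMl ?cog //.
  by rewrite rmorphM hornerM.
by rewrite hornerM g1 h1 mulr1.
Qed.

Lemma circ_ev1 v : circ_ev 1%g v = 1.
Proof.
by rewrite -(circ_poly1 F n_gt0) circ_ev_poly ?coprime1p ?hornerC // rmorph1 hornerC.
Qed.

Lemma circ_ev0 g : g \in C1 -> circ_ev g 0%N = 1.
Proof.
case/(poly_circP n_gt0)=> _ g1 _.
by rewrite /circ_ev expr0 -(rmorph1 emb) horner_map g1.
Qed.

Lemma circ_ev_neq0 g v : g \in C1 -> circ_ev g v != 0.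
Proof.
move=> Cg; apply: contra_eq_neq (circ_ev1 v) => g0.
by rewrite -(mulgV g) circ_evM ?groupV // g0 mul0r eq_sym oner_eq0.
Qed.

Lemma circ_ev_mod g v : circ_ev g (v %% n)%N = circ_ev g v.
Proof. by rewrite /circ_ev (prim_expr_mod prim_zeta). Qed.

Lemma circ_ev_gen k v : circ_ev (circ_gen F n ^+ k)%g v = zeta ^+ (k * v).
Proof.
rewrite -circ_poly_genX // circ_ev_poly ?coprimep_expl ?coprimeX_Xn1 //.
  by rewrite rmorphXn /= map_polyX !hornerE -exprM mulnC.
by rewrite !hornerE expr1n.
Qed.

Lemma expr_cardD (x y : K) : (x + y) ^+ q = x ^+ q + y ^+ q.
Proof.
have [p p_pr charFp] := finPcharP F.
have charKp : p \in [pchar K] by apply: (rmorph_pchar emb).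
by rewrite exprDn_pchar // (eq_pnat _ (pcharf_eq charKp)) pchar_nat_card.
Qed.

(** The q-th power map is additive and fixes the coefficients, which come from F, so it only moves
    the evaluation point. *)
Lemma circ_ev_frob g v : circ_ev g v ^+ q = circ_ev g (q * v)%N.
Proof.
rewrite /circ_ev [(q * v)%N]mulnC exprM; move: (zeta ^+ v) => x.
have q_gt0 : (0 < q)%N by apply: (@ltn_trans 1); rewrite // finNzRing_gt1.
elim/poly_ind: (poly_circ g) => [|p c IHp].
  by rewrite rmorph0 !horner0 expr0n eqn0Ngt q_gt0.
rewrite rmorphD rmorphM /= map_polyX map_polyC /= !hornerE.
by rewrite expr_cardD exprMn IHp -rmorphXn expf_card.
Qed.

Lemma circ_ev_inj g h : g \in C1 -> h \in C1 ->
  (forall v, circ_ev g v = circ_ev h v) -> g = h.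
Proof.
move=> /(poly_circP n_gt0)[_ _ gE] /(poly_circP n_gt0)[_ _ hE] gh.
suff pgh : poly_circ g = poly_circ h by rewrite -gE pgh hE.
apply/eqP; rewrite -subr_eq0 -(map_poly_eq0 emb); set r := map_poly _ _.
apply/eqP; apply: (@roots_geq_poly_eq0 _ r [seq zeta ^+ v | v : 'I_n]).
- apply/allP=> x /mapP[v _ ->]; rewrite /root /r rmorphB !hornerE.
  by rewrite -[X in X - _]/(circ_ev g v) gh subrr.
- rewrite map_inj_uniq ?enum_uniq // => u v /eqP.
  by rewrite (eq_prim_root_expr prim_zeta) !modn_small // => /eqP/val_inj.
- rewrite size_map size_enum_ord size_map_poly.
  by rewrite (leq_trans (size_polyD _ _)) // size_polyN geq_max !size_poly.
Qed.

Lemma circ_ev_surj (y : nat -> K) :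
  (forall v, y v != 0) -> y 0%N = 1 -> (forall v, y (v %% n)%N = y v) ->
  (forall v, y (q * v)%N = y v ^+ q) ->
  exists2 g, g \in C1 & forall v, circ_ev g v = y v.
Proof.
move=> y_neq0 y0 y_mod y_frob.
have q_gt0 : (0 < q)%N by apply: (@ltn_trans 1); rewrite // finNzRing_gt1.
have nF_neq0 : n%:R != 0 :> F by apply: natr_card_neq0.
have nK_neq0 : n%:R != 0 :> K by rewrite -(rmorph_nat emb) fmorph_eq0.
have zeta_neq0 : zeta != 0 by rewrite (prim_root_eq0 prim_zeta) -lt0n.
(* The inverse Fourier transform of y. *)
pose c i : K := n%:R^-1 * \sum_(v < n) y v * zeta^-1 ^+ (v * i).
pose hq (v : 'I_n) : 'I_n := Ordinal (ltn_pmod (q * v) n_gt0).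
have hq_inj : injective hq.
  have hq_le u v : hq u = hq v -> (v <= u)%N -> u = v.
    move=> /(congr1 val) /= /eqP uv le_vu; apply: val_inj; apply/eqP.
    rewrite eqn_leq le_vu andbT -subn_eq0 -(@modn_small (u - v) n).
      by move: uv; rewrite eqn_mod_dvd ?leq_mul2l ?le_vu ?orbT // -mulnBr Gauss_dvdr.
    by rewrite (leq_ltn_trans (leq_subr v u)).
  move=> u v huv; have [/hq_le-> //|/ltnW/hq_le->//] := leqP v u.
(* Since v -> qv permutes Z/n and y(qv) = y(v)^q, the q-th power only reorders the sum; by [fixK]
   the coefficients then lie in F. *)
have c_fix i : c i ^+ q = c i.
  have sumX (x : 'I_n -> K) : (\sum_v x v) ^+ q = \sum_v x v ^+ q.
    by apply: (big_morph (fun t => t ^+ q) expr_cardD); rewrite expr0n eqn0Ngt q_gt0.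
  rewrite /c exprMn sumX [in RHS](reindex_inj hq_inj) /=; congr (_ * _).
    by rewrite exprVn -(rmorph_nat emb) -rmorphXn expf_card.
  apply: eq_bigr => v _; rewrite exprMn y_mod y_frob; congr (_ * _).
  rewrite !exprVn; congr (_^-1); rewrite -!exprM; apply/eqP.
  by rewrite (eq_prim_root_expr prim_zeta) modnMml mulnC mulnA.
have a_ex i : exists x, emb x == c i.
  by have [x ->] := fixK (c_fix i); exists x.
pose p := \poly_(i < n) xchoose (a_ex i).
have p_ev w : (map_poly emb p).[zeta ^+ w] = y w.
  have size_p : (size (map_poly emb p) <= n)%N by rewrite size_map_poly size_poly.
  rewrite (horner_coef_wide _ size_p).
  rewrite (eq_bigr (fun i : 'I_n => \sum_(v < n) n%:R^-1 * (y v * (zeta ^+ w / zeta ^+ v) ^+ i))).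
    rewrite exchange_big /= -(y_mod w); have w_lt := ltn_pmod w n_gt0.
    rewrite (bigD1 (Ordinal w_lt)) //= [X in _ + X]big1 ?addr0 => [|v vw].
      rewrite -mulr_sumr -mulr_sumr (prim_expr_mod prim_zeta) divff ?expf_neq0 //.
      rewrite (eq_bigr (fun _ => 1)) => [|i _]; last by rewrite expr1n.
      by rewrite sumr_const card_ord mulrCA mulVf // mulr1.
    rewrite -mulr_sumr -mulr_sumr; set u := zeta ^+ w / _.
    have u1 : u != 1.
      apply: contra vw => /eqP u1; have : zeta ^+ w == zeta ^+ v.
        by rewrite -[_ ^+ w](divfK (expf_neq0 v zeta_neq0)) -/u u1 mul1r.
      rewrite (eq_prim_root_expr prim_zeta) [in X in _ == X]modn_small // => /eqP wv.
      by apply/eqP/val_inj; rewrite /= wv.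
    have := subrX1 u n; rewrite exprMn exprVn !zeta_n invr1 mulr1 subrr => /esym/eqP.
    by rewrite mulf_eq0 subr_eq0 (negPf u1) /= => /eqP->; rewrite !mulr0.
  move=> i _; rewrite coef_map coef_poly ltn_ord /= (eqP (xchooseP (a_ex i))) /c.
  rewrite -mulrA mulr_suml mulr_sumr; apply: eq_bigr => v _; congr (_ * _).
  by rewrite -mulrA exprMn !exprVn -!exprM [_^-1 * _]mulrC.
have p1 : p.[1] = 1.
  by apply: (fmorph_inj emb); rewrite -horner_map rmorph1 -[X in _.[X]](expr0 zeta) p_ev.
have cop : coprimep p Xn1.
  rewrite -(coprimep_map emb) rmorphB rmorphXn rmorph1 /= map_polyX.
  rewrite -(factor_Xn_sub_1 prim_zeta); apply: (big_ind (coprimep _)).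
  - exact: coprimep1.
  - by move=> u v cu cv; rewrite coprimepMr cu.
  - by move=> i _; rewrite coprimep_XsubC /root p_ev.
by exists (circ_poly n p) => [|v]; [apply: circ_poly_units1 | rewrite circ_ev_poly].
Qed.

End Evaluation.

(** * The coprime case *)

(** [D] and [T] embed A and G into the functions from Z/n to K^* with the same image. Periodicity
    reduces equality of functions to n values, a decidable condition, so that matching elements can
    be chosen. *)
Lemma zmod_isog_common_image (A : zmodType) (gT : finGroupType) (G : {group gT})
    (n : nat) (n_gt0 : (0 < n)%N) (K : fieldType) (D : A -> nat -> K) (T : gT -> nat -> K) :
  (forall a v, D a (v %% n)%N = D a v) -> (forall g v, T g (v %% n)%N = T g v) ->
  (forall a b v, D (a + b) v = D a v * D b v) ->
  (forall a, (forall v, D a v = 1) -> a = 0) ->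
  {in G &, forall g h v, T (g * h)%g v = T g v * T h v} ->
  {in G &, forall g h, (forall v, T g v = T h v) -> g = h} ->
  {in G, forall g v, T g v != 0} ->
  (forall a, exists2 g, g \in G & forall v, T g v = D a v) ->
  {in G, forall g, exists a, forall v, D a v = T g v} ->
  zmod_isog A G.
Proof.
move=> D_mod T_mod D_M D_1 T_M T_inj T_neq0 D_T T_D.
pose R a g := (g \in G) && [forall v : 'I_n, T g v == D a v].
have RP a g : reflect (g \in G /\ forall v, T g v = D a v) (R a g).
  apply: (iffP andP) => -[Gg Tg]; split=> //.
    by move=> v; rewrite -T_mod -D_mod; apply/eqP/(forallP Tg (Ordinal (ltn_pmod v n_gt0))).
  by apply/forallP=> v; rewrite Tg.
have exR a : exists g, R a g by have [g Gg Tg] := D_T a; exists g; apply/RP.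
pose f a := xchoose (exR a).
have fP a : f a \in G /\ forall v, T (f a) v = D a v by apply/RP/xchooseP.
have D_neq0 a v : D a v != 0.
  by have [Gf <-] := fP a; apply: T_neq0.
exists f; split=> [a b|a b fab|g].
- have [[Gab Tab] [Ga Ta] [Gb Tb]] := And3 (fP (a + b)) (fP a) (fP b).
  by apply: T_inj; rewrite ?groupM // => v; rewrite T_M // Tab Ta Tb D_M.
- apply/eqP; rewrite -subr_eq0; apply/eqP/D_1 => v.
  apply: (mulIf (D_neq0 b v)); rewrite -D_M subrK mul1r.
  by have [[_ <-] [_ <-]] := (fP a, fP b); rewrite fab.
split=> [Gg|[a <-]]; last by have [] := fP a.
have [a Da] := T_D g Gg; exists a; have [Ga Ta] := fP a.
by apply: T_inj => // v; rewrite Ta Da.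
Qed.

Section Torsion.
Variables (n d k N : nat) (A : zmodType) (E : nat -> A).
Hypotheses (dk : (d ^ k = N.+1)%N) (n_N : (n %| N)%N).

(** Iterating the relation gives d^k E_v = E_(d^k v), which is E_v because d^k = N + 1 is 1 modulo
    n. *)
Lemma Sigma_torsion : presentation n d [:: 0%N] E -> forall a : A, a *+ N = 0.
Proof.
move=> presE a; have E_X j v : E v *+ (d ^ j) = E (d ^ j * v)%N.
  elim: j => [|j IHj] in v *; first by rewrite mul1n.
  by rewrite expnS mulrnA (pres_rel presE) big_seq1 addn0 IHj mulnCA mulnA.
have [c ->] := pres_gen presE a; rewrite -sumrMnl big1 // => v _.
rewrite pmulrn mulrzAC -pmulrn; suff -> : E v *+ N = 0 by rewrite mul0rz.
apply: (addIr (E v)); rewrite add0r -mulrSr -dk E_X dk.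
rewrite -(pres_mod presE) -modnMml -add1n.
by have /dvdnP[s ->] := n_N; rewrite addnC modnMDl modnMml mul1n (pres_mod presE).
Qed.

(** With N = s n, iterating the relation spreads d^k E_v over s full periods and one extra term E_v.
    At v = 0 this shows that s times the sum over a period is 0. *)
Lemma Sandpile_torsion : presentation n d (iota 0 d) E -> forall a : A, a *+ N = 0.
Proof.
move=> presE a; have /dvdnP[s N_s] := n_N.
have sum_iota (B : zmodType) (f : nat -> B) m : \sum_(i <- iota 0 m) f i = \sum_(i < m) f i.
  by rewrite -[m in LHS]subn0 big_mkord.
have E_X j v : E v *+ (d ^ j) = \sum_(u < d ^ j) E (d ^ j * v + u)%N.
  elim: j => [|j IHk]; first by rewrite big_ord1 mul1n addn0.
  rewrite expnSr mulrnA IHk -sumrMnl.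
  rewrite (sum_nat_blocks (fun u => E (d ^ j * d * v + u)%N)); apply: eq_bigr => u _.
  rewrite (pres_rel presE) sum_iota; apply: eq_bigr => i _; congr E.
  by rewrite mulnDr addnA mulnA [(d * d ^ j)%N]mulnC [(u * d)%N]mulnC.
have E_shift v : \sum_(u < n) E (v + u)%N = \sum_(u < n) E u.
  elim: v => [|v IHv] //; rewrite -[RHS]IHv.
  apply: (addIr (E v)); transitivity (\sum_(u < n.+1) E (v + u)%N).
    rewrite big_ord_recl /= addn0 addrC; congr (_ + _).
    by apply: eq_bigr => u _; rewrite addSnnS.
  rewrite big_ord_recr /=; congr (_ + _).
  by rewrite -(pres_mod presE) modnDr (pres_mod presE).
have E_dk v : E v *+ (d ^ k) = (\sum_(u < n) E u) *+ s + E v.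
  rewrite E_X dk big_ord_recr /= N_s.
  have E_modq u : E ((s * n).+1 * v + u)%N = E (v + u)%N.
    rewrite mulSn mulnAC addnAC addnC -(pres_mod presE) modnMDl.
    exact: (pres_mod presE).
  rewrite E_modq -[E (v + _)%N](pres_mod presE) addnC modnMDl (pres_mod presE).
  congr (_ + _); rewrite (sum_nat_blocks (fun u => E ((s * n).+1 * v + u)%N)).
  rewrite (eq_bigr (fun _ => \sum_(u < n) E u)) ?sumr_const ?card_ord // => j _.
  rewrite -[RHS](E_shift (v + j * n)%N); apply: eq_bigr => u _.
  by rewrite E_modq addnA.
have sum_s : (\sum_(u < n) E u) *+ s = 0.
  by have := E_dk 0%N; rewrite (pres0 presE) mul0rn addr0 => /esym.
have [c ->] := pres_gen presE a; rewrite -sumrMnl big1 // => v _.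
rewrite pmulrn mulrzAC -pmulrn; suff -> : E v *+ N = 0 by rewrite mul0rz.
by apply: (addIr (E v)); rewrite add0r -mulrSr -dk E_dk sum_s add0r.
Qed.

End Torsion.

Section CoprimeCase.
Variables (F : finFieldType) (n : nat) (n_gt0 : (0 < n)%N).
Variables (K : finFieldType) (emb : {rmorphism F -> K}) (zeta : K) (r : nat).
Local Notation q := #|F|.
Hypothesis prim_zeta : n.-primitive_root zeta.
Hypothesis fixK : forall y : K, y ^+ q = y -> exists x, y = emb x.
Hypothesis co_nq : coprime n q.
Hypothesis cardK : #|K| = (q ^ r)%N.
Local Notation N := #|K|.-1.
Local Notation C1 := (circ_units1 F n).
Local Notation ev := (@circ_ev F n K emb zeta).
Local Notation x := (circ_gen F n).

Let N_gt0 : (0 < N)%N. Proof. by rewrite ltn_predRL finNzRing_gt1. Qed.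
Let cardK_N : #|K| = N.+1.
Proof. by rewrite prednK // (ltn_trans _ (finNzRing_gt1 K)). Qed.

Let expr_N (y : K) : y != 0 -> y ^+ N = 1.
Proof.
by move=> y0; apply: (mulfI y0); rewrite -exprS -cardK_N expf_card mulr1.
Qed.

Let n_dvd_N : (n %| N)%N.
Proof.
rewrite (prim_order_dvd prim_zeta) expr_N //.
by rewrite (prim_root_eq0 prim_zeta) -lt0n.
Qed.

Lemma finField_generator : exists2 z : K, N.-primitive_root z &
  forall y, y != 0 -> exists k, y = z ^+ k.
Proof.
have /hasP[z _ pz] : has N.-primitive_root (enum [pred y : K | y != 0]).
  apply: has_prim_root; rewrite ?enum_uniq ?N_gt0 //.
    by apply/allP=> y; rewrite mem_enum inE unity_rootE => /expr_N->.
  by rewrite -cardE (cardC1 0).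
exists z => // y y0; have [k ->] := prim_rootP pz (expr_N y0).
by exists k.
Qed.

Lemma coprime_Sigma_isog (A : zmodType) (E : nat -> A) :
  presentation n q [:: 0%N] E -> zmod_isog A (circ_units1_group F n).
Proof.
move=> presE.
have [z prim_z zP] := finField_generator.
have E_N : forall a : A, a *+ N = 0.
  by apply: (Sigma_torsion (k := r) _ n_dvd_N presE); rewrite -cardK.
have [D [[D_mod D0 D_rel D_neq0] D_M D_1 D_surj]] := presentation_dual n_gt0 presE N_gt0 prim_z E_N.
apply: (zmod_isog_common_image n_gt0 (T := ev) D_mod) => //.
- by move=> g v; apply: circ_ev_mod.
- by move=> g h Cg Ch v; apply: circ_evM.
- by move=> g h Cg Ch; apply: circ_ev_inj.
- by move=> g Cg v; apply: circ_ev_neq0.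
- by move=> a; apply: circ_ev_surj => // v; rewrite D_rel big_seq1 addn0.
- move=> g Cg; apply: D_surj.
  + by move=> v; apply: zP; apply: circ_ev_neq0.
  + by move=> v; apply: circ_ev_mod.
  + exact: circ_ev0.
  + by move=> v; rewrite big_seq1 addn0 circ_ev_frob.
Qed.

Local Notation cx := <[x]>%g.

Definition circ_ev_ratio (g : {'GL_n[F]}) v := ev g v.+1 / (ev g v * ev g 1%N).
Local Notation t := circ_ev_ratio.

Let genX_C1 k : (x ^+ k)%g \in circ_units1_group F n.
Proof. by rewrite groupX // circ_gen_units1. Qed.

Let ev_mod g v : ev g (v %% n)%N = ev g v.
Proof. exact: circ_ev_mod. Qed.
Let evM g h v : g \in C1 -> h \in C1 -> ev (g * h)%g v = ev g v * ev h v.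
Proof. exact: circ_evM. Qed.
Let ev0 g : g \in C1 -> ev g 0%N = 1. Proof. exact: circ_ev0. Qed.
Let ev_neq0 g v : g \in C1 -> ev g v != 0. Proof. exact: circ_ev_neq0. Qed.
Let ev_gen k v : ev (x ^+ k)%g v = zeta ^+ (k * v). Proof. exact: circ_ev_gen. Qed.

Lemma circ_ev_ratio_mod g v : t g (v %% n)%N = t g v.
Proof.
rewrite /t ev_mod; congr (_ / _); rewrite -ev_mod -addn1 modnDml addn1.
by rewrite ev_mod.
Qed.

Lemma circ_ev_ratioM g h v : g \in C1 -> h \in C1 -> t (g * h)%g v = t g v * t h v.
Proof. by move=> Cg Ch; rewrite /t !evM // mulf_div [X in _ / X = _]mulrACA. Qed.

Lemma circ_ev_ratio_neq0 g v : g \in C1 -> t g v != 0.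
Proof. by move=> Cg; rewrite mulf_neq0 ?invr_neq0 ?mulf_neq0 ?ev_neq0. Qed.

Lemma circ_ev_ratio_gen k v : t (x ^+ k)%g v = 1.
Proof.
rewrite /t !ev_gen muln1 mulnS exprD [zeta ^+ k * _]mulrC divff //.
by rewrite mulf_neq0 ?expf_neq0 // (prim_root_eq0 prim_zeta) -lt0n.
Qed.

(** Trivial ratios make the transform geometric, v -> c^v, and periodicity makes c an n-th root of
    unity. *)
Lemma circ_ev_ratio_eq1 g : g \in C1 -> (forall v, t g v = 1) -> g \in cx.
Proof.
move=> Cg tg1; pose c := ev g 1%N.
have ev_c v : ev g v = c ^+ v.
  elim: v => [|v IHv]; first by rewrite ev0.
  have := tg1 v; rewrite /t => /(canRL (divfK _)) ->.
    by rewrite mul1r IHv exprSr.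
  by rewrite mulf_neq0 ?ev_neq0.
have /(prim_rootP prim_zeta)[k c_k] : c ^+ n = 1.
  by rewrite -ev_c -ev_mod modnn ev0.
have -> : g = (x ^+ k)%g.
  apply: (circ_ev_inj (emb := emb) n_gt0 prim_zeta Cg) => [|v]; first exact: genX_C1.
  by rewrite ev_c c_k ev_gen exprM.
exact: mem_cycle.
Qed.

Lemma coprime_Sandpile_isog (A : zmodType) (E : nat -> A) :
  presentation n q (iota 0 q) E -> zmod_isog A (circ_units1_group F n / cx)%G.
Proof.
move=> presE.
have [z prim_z zP] := finField_generator.
have /dvdnP[s N_s] := n_dvd_N.
have prod_iota (f : nat -> K) k : \prod_(i <- iota 0 k) f i = \prod_(i < k) f i.
  by rewrite -[k in LHS]subn0 big_mkord.
have E_N : forall a : A, a *+ N = 0.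
  by apply: (Sandpile_torsion (k := r) _ n_dvd_N presE); rewrite -cardK.
have [D [[D_mod D0 D_rel D_neq0] D_M D_1 D_surj]] :=
  presentation_dual n_gt0 presE N_gt0 prim_z E_N.
pose T (C : coset_of cx) := t (fingroup.repr C).
have reprP g : g \in C1 -> exists k, fingroup.repr (coset cx g) = (x ^+ k * g)%g.
  move=> Cg; have Ng : g \in 'N(cx)%g by apply: (subsetP (normal_norm (circ_gen_normal F n))).
  have := mem_repr_coset (coset cx g); rewrite val_coset // => /rcosetP[h /cycleP[k ->] ->].
  by exists k.
have TE g v : g \in C1 -> T (coset cx g) v = t g v.
  move=> Cg; rewrite /T; have [k ->] := reprP g Cg.
  by rewrite circ_ev_ratioM ?genX_C1 // circ_ev_ratio_gen mul1r.
have Gcx C : C \in (circ_units1_group F n / cx)%G -> exists2 g, g \in C1 & C = coset cx g.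
  by case/morphimP=> g _ Cg ->; exists g.
have Ncx g : g \in C1 -> g \in 'N(cx)%g.
  by apply: (subsetP (normal_norm (circ_gen_normal F n))).
apply: (zmod_isog_common_image n_gt0 (T := T) D_mod) => //.
- by move=> C v; apply: circ_ev_ratio_mod.
- move=> _ _ /Gcx[g Cg ->] /Gcx[h Ch ->] v.
  by rewrite -morphM ?Ncx // !TE ?groupM // circ_ev_ratioM.
- move=> _ _ /Gcx[g Cg ->] /Gcx[h Ch ->] Tgh.
  have gh : (g * h^-1)%g \in cx.
    apply: circ_ev_ratio_eq1 => [|v]; first by rewrite groupM ?groupV.
    apply: (mulIf (circ_ev_ratio_neq0 v Ch)); rewrite -circ_ev_ratioM ?groupM ?groupV //.
    by rewrite mulgKV mul1r -!TE.
  by rewrite -[g](mulgKV h) morphM ?Ncx ?groupM ?groupV //= (coset_id gh) mul1g.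
- by move=> _ /Gcx[g Cg ->] v; rewrite TE // circ_ev_ratio_neq0.
(* To recover y from its ratios, take partial products. They are compatible with Frobenius, but a
   shift by n multiplies them by [H n]; a twist by c^v with c^n = 1 / H n restores periodicity. *)
- move=> a; pose H v := \prod_(i < v) D a i.
  have H_neq0 v : H v != 0 by apply/prodf_neq0 => i _; apply: D_neq0.
  have HS v : H v.+1 = H v * D a v by rewrite /H big_ord_recr.
  have H_split u w : H (u + w)%N = H u * \prod_(i < w) D a (u + i)%N.
    by rewrite /H big_split_ord.
  have H_add v u : H (v * n + u)%N = H n ^+ v * H u.
    elim: v => [|v IHv]; first by rewrite expr0 mul1r.
    rewrite mulSn -addnA H_split exprS -mulrA -IHv; congr (_ * _).
    by apply: eq_bigr => i _; rewrite -D_mod modnDl D_mod.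
  have H_frob v : H (q * v)%N = H v ^+ q.
    elim: v => [|v IHv]; first by rewrite muln0 /H big_ord0 expr1n.
    by rewrite mulnS addnC H_split IHv HS exprMn D_rel prod_iota.
  have H_frobX k v : H (q ^ k * v)%N = H v ^+ (q ^ k).
    elim: k => [|k IHk] in v *; first by rewrite mul1n expr1.
    by rewrite expnSr -mulnA IHk H_frob -exprM mulnC.
  have H1 : H 1%N = 1 by rewrite /H big_ord1 D0.
  (* Compute H at q^r = s n + 1 twice: Frobenius gives H(1)^(q^r) = 1, and shifting by s periods
     gives H(n)^s. *)
  have Hn_s : H n ^+ s = 1.
    have := H_add s 1%N; rewrite H1 mulr1 => <-.
    by rewrite addn1 -N_s -cardK_N cardK -[(q ^ r)%N]muln1 H_frobX H1 expr1n.
  (* K^* is cyclic of order s n, so an element killed by s is an n-th power. *)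
  have [c c_n] : exists c, c ^+ n * H n = 1.
    have [j Hn_j] := zP _ (H_neq0 n).
    have /dvdnP[j' j_j'] : (n %| j)%N.
      have s_gt0 : (0 < s)%N by move: N_gt0; rewrite N_s muln_gt0 => /andP[].
      by rewrite -(dvdn_pmul2l s_gt0) -N_s (prim_order_dvd prim_z) mulnC exprM -Hn_j Hn_s.
    exists (z^-1 ^+ j'); rewrite -exprM -j_j' Hn_j exprVn mulVf // -Hn_j; exact: H_neq0.
  have c_neq0 : c != 0.
    by apply: contraTneq (oner_neq0 K) => c0; rewrite -c_n c0 expr0n eqn0Ngt n_gt0 mul0r eqxx.
  pose y v := c ^+ v * H v.
  have [||||g Cg gy] := circ_ev_surj n_gt0 prim_zeta fixK co_nq (y := y).
  + by move=> v; rewrite mulf_neq0 ?expf_neq0.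
  + by rewrite /y expr0 mul1r /H big_ord0.
  + move=> v; rewrite {2}(divn_eq v n) /y H_add exprD mulrACA [(_ * n)%N]mulnC exprM.
    by rewrite -exprMn c_n expr1n mul1r.
  + by move=> v; rewrite /y H_frob exprMn -exprM mulnC.
  exists (coset cx g) => [|v]; first by rewrite mem_quotient.
  rewrite TE // /t !gy /y HS H1 mulr1 expr1 exprSr.
  by field; rewrite c_neq0 H_neq0 expf_neq0.
- move=> _ /Gcx[g Cg ->]; have [||||a Da] := D_surj (t g).
  + by move=> v; apply: zP; apply: circ_ev_ratio_neq0.
  + exact: circ_ev_ratio_mod.
  + by rewrite /t ev0 // mul1r divff // ev_neq0.
  (* The product of consecutive ratios telescopes; for w = qv and k = q it is the q-th power of the
     ratio at v. *)
  + move=> v; have prod_t w k :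
        \prod_(i < k) t g (w + i)%N = ev g (w + k)%N / (ev g w * ev g 1%N ^+ k).
      elim: k => [|k IHk]; first by rewrite big_ord0 addn0 expr0 mulr1 divff ?ev_neq0.
      rewrite big_ord_recr /= IHk /t addnS exprSr.
      by field; rewrite !ev_neq0 ?expf_neq0 ?ev_neq0.
    by rewrite prod_iota prod_t /t expr_div_n exprMn !circ_ev_frob mulnS muln1 addnC.
  by exists a => v; rewrite TE.
Qed.

End CoprimeCase.

(** A splitting field of X^n - 1 works: n is invertible in F, so the roots are n distinct ones, and
    Fermat's little theorem identifies the fixed points of the q-th power map with F. *)
Lemma exists_prim_root_extension (F : finFieldType) n :
  (0 < n)%N -> coprime n #|F| ->
  exists (K : finFieldType) (emb : {rmorphism F -> K}) (zeta : K) (r : nat),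
    [/\ n.-primitive_root zeta, #|K| = (#|F| ^ r)%N
      & forall y : K, y ^+ #|F| = y -> exists x, y = emb x].
Proof.
move=> n_gt0 co_nq.
have nz : 'X^n - 1 != 0 :> {poly F} by apply: Xn1_neq0.
have [L [rs rsE _]] := FinSplittingFieldFor nz.
pose K : finFieldType := finvect_type L.
pose emb : {rmorphism F -> K} := in_alg L.
have rsE' : ('X^n - 1 : {poly L}) %= \prod_(z <- rs) ('X - z%:P).
  by move: rsE; rewrite rmorphB rmorphXn rmorph1 /= map_polyX.
have size_rs : size rs = n.
  by apply/eqP; rewrite -eqSS -(size_prod_XsubC rs id) -(eqp_size rsE') size_XnsubC.
have nL : n%:R != 0 :> L.
  by rewrite -(rmorph_nat (in_alg L)) fmorph_eq0 natr_card_neq0.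
have uniq_rs : uniq rs.
  rewrite -separable_prod_XsubC -(eqp_separable rsE').
  by apply: separable_Xn_sub_1.
have /hasP[zeta _ prim_zeta] : has n.-primitive_root rs.
  apply: has_prim_root; rewrite ?size_rs //; apply/allP=> x rs_x.
  rewrite /root_of_unity (eqp_root rsE') root_prod_XsubC //.
exists K, emb, zeta, (\dim {:finvect_type L}); split=> //.
  have := @card_vspace F (finvect_type L) (Vector.class (finvect_type L)) fullv.
  by rewrite card_vspacef.
move=> y yq; have : y \in (1%AS : {subfield L}).
  by rewrite Fermat's_little_theorem dimv1 expn1 yq.
by case/vlineP=> x ->; exists x.
Qed.

(** * Reduction of circulants from np to n *)

Lemma finite_generation (A : zmodType) (E : nat -> A) n M :
  (0 < M)%N -> (forall a, exists c : nat -> int, a = \sum_(v < n) E v *~ c v) ->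
  (forall a : A, a *+ M = 0) -> exists s : seq A, forall a, a \in s.
Proof.
move=> M_gt0 gen A_M.
exists [seq \sum_(v < n) E v *+ c v | c : {ffun 'I_n -> 'I_M}] => a.
have M_neq0 : M%:Z != 0 by rewrite eqz_nat -lt0n.
have c_lt (x : int) : (`|(x %% M%:Z)%Z|%N < M)%N.
  by rewrite -ltz_nat gez0_abs ?modz_ge0 // ltz_pmod.
have [c ->] := gen a; apply/mapP; exists [ffun v : 'I_n => Ordinal (c_lt (c v))].
  by rewrite mem_enum.
apply: eq_bigr => v _; rewrite ffunE /= pmulrn gez0_abs ?modz_ge0 //.
by rewrite {1}(divz_eq (c v) M) mulrzDr mulrC mulrzA -pmulrn A_M mul0rz add0r.
Qed.

Lemma zmod_isog_reduction (p n : nat) (o : seq nat) (i0 : nat) (A A' : zmodType)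
    (E : nat -> A) (E' : nat -> A') (gT rT : finGroupType)
    (G : {group gT}) (G' : {group rT}) (h : gT -> rT) :
  prime p -> (0 < n)%N -> uniq o -> (forall i, i \in o -> (i < p)%N) -> i0 \in o ->
  (i0 = 0%N -> o = [:: 0%N]) ->
  presentation (n * p) p o E -> presentation n p o E' -> zmod_isog A' G' ->
  abelian G -> {in G &, {morph h : x y / (x * y)%g}} -> h @: G = G' ->
  {in G, forall g, h g = 1%g <-> (g ^+ p)%g = 1%g} ->
  #|'Ldiv_p(G)%g| = (p ^ (n * p - n - (i0 != 0)%N))%N ->
  zmod_isog A G.
Proof.
move=> p_pr n_gt0 o_uniq o_lt o_i0 o_0 presE presE' [f [fM f_inj fG']] cGG hM hG' h1 cardG.
have p_gt0 := prime_gt0 p_pr.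
have [red [red_surj red0 red0']] := reduction_exists p_pr n_gt0 o_uniq o_lt o_i0 presE presE'.
have [k [k_surj k0 k0']] := cotorsion_exists p_pr n_gt0 o_uniq o_lt o_i0 o_0 presE.
have f0 : f 0 = 1%g by apply: (mulgI (f 0)); rewrite -fM addr0 mulg1.
have fX a m : f (a *+ m) = (f a ^+ m)%g.
  by elim: m => [|m IHm]; rewrite ?mulr0n ?f0 // mulrS fM IHm expgS.
(* A is finitely generated and killed by |G'| p: the reduction of |G'| a is 0, hence |G'| a is
   p-torsion. *)
have [||s sP] := finite_generation (M := #|G'| * p) _ (pres_gen presE).
- by rewrite muln_gt0 cardG_gt0.
- move=> a; rewrite mulrnA; apply: red0; apply: f_inj; rewrite raddfMn f0 fX.
  by apply: expg_cardG; apply/fG'; exists (red a).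
apply: (zmod_isog_torsion (G' := G') (r := f \o red) (h := h) (k := k) sP p_pr cGG) => //.
- by move=> a b /=; rewrite raddfD fM.
- move=> g; split=> [/fG'[a' <-]|[a <-]]; last by apply/fG'; exists (red a).
  by have [a <-] := red_surj a'; exists a.
- by move=> a /=; rewrite -f0 => /f_inj/red0.
- by move=> a /= /red0' ->.
- by move=> g Gg /h1; apply.
- by move=> g Gg /h1; apply.
- exact: raddfD.
by rewrite cardG card_mx mul1n card_Fp // (card_nonpivots p_pr n_gt0 o_lt o_i0).
Qed.

(** * Reduction modulo the powers of X *)

Section QuotientReduction.
Import GroupScope.
Variables (gT rT : finGroupType) (G : {group gT}) (G' : {group rT}).
Variables (red : gT -> rT) (x : gT) (x' : rT) (p : nat).
Hypotheses (cGG : abelian G) (cGG' : abelian G') (Gx : x \in G) (Gx' : x' \in G').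
Hypothesis redM : {in G &, {morph red : g h / g * h}}.
Hypothesis red_im : red @: G = G'.
Hypothesis red_eq1 : {in G, forall g, red g = 1 <-> g ^+ p = 1}.
Hypothesis red_x : forall k, red (x ^+ k) = x' ^+ k.
Hypothesis x_frob : forall g k, g \in G -> g ^+ p = x ^+ k -> (p %| k)%N.

Let nx : <[x]> <| G.
Proof. by rewrite -sub_abelian_normal ?cycle_subG. Qed.
Let nx' : <[x']> <| G'.
Proof. by rewrite -sub_abelian_normal ?cycle_subG. Qed.
Let Nx g : g \in G -> g \in 'N(<[x]>). Proof. exact: (subsetP (normal_norm nx)). Qed.
Let Nx' g : g \in G' -> g \in 'N(<[x']>). Proof. exact: (subsetP (normal_norm nx')). Qed.
Let redG g : g \in G -> red g \in G'.
Proof. by move=> Gg; rewrite -red_im imset_f. Qed.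

Definition red_coset (C : coset_of <[x]>) : coset_of <[x']> :=
  coset <[x']> (red (fingroup.repr C)).

Lemma red_cosetE g : g \in G -> red_coset (coset <[x]> g) = coset <[x']> (red g).
Proof.
move=> Gg; rewrite /red_coset; have := mem_repr_coset (coset <[x]> g).
rewrite val_coset ?Nx // => /rcosetP[h /cycleP[k ->] ->].
rewrite redM ?groupX // red_x morphM ?Nx' ?redG ?groupX //=.
by rewrite coset_id ?mul1g // mem_cycle.
Qed.

Let quoP C : C \in G / <[x]> -> exists2 g, g \in G & C = coset <[x]> g.
Proof. by case/morphimP=> g _ Gg ->; exists g. Qed.

Lemma red_cosetM : {in G / <[x]> &, {morph red_coset : g h / g * h}}.
Proof.
move=> _ _ /quoP[g Gg ->] /quoP[h Gh ->].
rewrite -morphM ?Nx //= !red_cosetE ?groupM // redM //.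
by rewrite morphM ?Nx' ?redG.
Qed.

Lemma red_coset_im : red_coset @: (G / <[x]>) = G' / <[x']>.
Proof.
apply/setP=> C; apply/imsetP/idP => [[_ /quoP[g Gg ->] ->]|].
  by rewrite red_cosetE // mem_quotient ?redG.
case/morphimP=> g _; rewrite -red_im => /imsetP[h Gh ->] ->.
by exists (coset <[x]> h); rewrite ?mem_quotient ?red_cosetE.
Qed.

Let red_expg g k : g \in G -> red g = x' ^+ k <-> g ^+ p = x ^+ (k * p).
Proof.
move=> Gg; have Ggk : g * (x ^+ k)^-1 \in G by rewrite groupM ?groupV ?groupX.
have gk : commute g (x ^+ k)^-1 by apply: (centsP cGG); rewrite ?groupV ?groupX.
have := red_eq1 Ggk; rewrite expgMn // expVgn -expgM => -[red1 red2].
have redE : red g = red (g * (x ^+ k)^-1) * x' ^+ k.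
  by rewrite -red_x -redM ?groupX // mulgKV.
split=> [rg|gp].
  apply/eqP; rewrite eq_mulgV1; apply/eqP/red1; apply: (mulIg (x' ^+ k)).
  by rewrite -redE rg mul1g.
by rewrite redE red2 ?mul1g // gp mulgV.
Qed.

(** If g^p = x^k, then [x_frob] gives k = jp, so g x^(-j) is p-torsion and is killed by [red]; hence
    red g = x'^j. *)
Lemma red_coset_eq1 :
  {in G / <[x]>, forall C, red_coset C = 1 <-> C ^+ p = 1}.
Proof.
move=> _ /quoP[g Gg ->]; rewrite red_cosetE // -morphX ?Nx //=.
split=> [/coset_idr|/coset_idr].
  move=> /(_ (Nx' (redG Gg)))/cycleP[k /(red_expg _ Gg) ->].
  by rewrite coset_id // mem_cycle.
have Np : g ^+ p \in 'N(<[x]>) by rewrite Nx ?groupX.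
move=> /(_ Np)/cycleP[k gk]; have /dvdnP[j kj] := x_frob Gg gk.
rewrite kj in gk; have /(red_expg _ Gg)-> := gk.
by rewrite coset_id // mem_cycle.
Qed.

(** Compare |G| = |G[p]| |G'| with the same formula for the quotients by <x> and <x'>; the factor p
    is the ratio of the orders of x and x'. *)
Lemma card_quotient_Ldiv : #[x] = (#[x'] * p)%N ->
  (p * #|'Ldiv_p(G / <[x]>)| = #|'Ldiv_p(G)|)%N.
Proof.
move=> ox; have cardL (aT bT : finGroupType) (A : {group aT}) (B : {group bT}) (h : aT -> bT) :
    {in A &, {morph h : u v / u * v}} -> h @: A = B ->
    {in A, forall g, h g = 1 <-> g ^+ p = 1} -> #|A| = (#|'Ldiv_p(A)| * #|B|)%N.
  move=> hM hA h1; pose hm := Morphism hM.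
  have <- : 'ker hm = 'Ldiv_p(A).
    apply/setP=> g; apply/idP/LdivP=> [gk|[Ag gp]].
      by have Ag := dom_ker gk; split=> //; apply/(h1 g Ag); have := mker gk.
    by apply/kerP=> //=; apply/(h1 g Ag).
  have -> : B = (hm @* A)%G by apply: val_inj; rewrite /= morphimEdom.
  by rewrite card_morphim setIid Lagrange // subsetIl.
have cardQ (aT : finGroupType) (A : {group aT}) y :
    <[y]> <| A -> #|A| = (#[y] * #|A / <[y]>|)%N.
  by move=> ny; rewrite card_quotient ?normal_norm // Lagrange // normal_sub.
have := cardL _ _ _ _ _ redM red_im red_eq1; rewrite (cardQ _ _ _ nx) (cardQ _ _ _ nx').
have := cardL _ _ (G / <[x]>)%G (G' / <[x']>)%G _ red_cosetM red_coset_im red_coset_eq1.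
move=> /= ->; rewrite ox mulnA [in RHS]mulnA => /eqP; rewrite eqn_pmul2r ?cardG_gt0 //.
by rewrite -mulnA [in X in _ == X]mulnC eqn_pmul2l // => /eqP.
Qed.

End QuotientReduction.

Section ReduceCirculant.
Variables (F : finFieldType) (p n : nat).
Hypotheses (n_gt0 : (0 < n)%N) (charFp : p \in [pchar F]).
Local Notation C1 m := (circ_units1_group F m).
Local Notation X1 m := ('X^m - 1 : {poly F}).
Local Notation x m := (circ_gen F m).

Let p_pr : prime p. Proof. exact: pcharf_prime charFp. Qed.
Let p_gt0 : (0 < p)%N. Proof. exact: prime_gt0. Qed.
Let np_gt0 : (0 < n * p)%N. Proof. by rewrite muln_gt0 n_gt0. Qed.

Lemma expr_polyB (P Q : {poly F}) : (P - Q) ^+ p = P ^+ p - Q ^+ p.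
Proof.
have charP : p \in [pchar {poly F}] by rewrite pchar_poly.
by rewrite -!(pFrobenius_autE charP) rmorphB.
Qed.

(** This identity links the levels: both moduli have the same coprime polynomials, and P^p = Q^p at
    level np means P = Q at level n. *)
Lemma Xn1_frob : X1 (n * p) = X1 n ^+ p.
Proof. by rewrite expr_polyB exprM expr1n. Qed.

Lemma coprime_Xn1_frob P : coprimep P (X1 (n * p)) = coprimep P (X1 n).
Proof. by rewrite Xn1_frob coprimep_pexpr. Qed.

Lemma dvdp_Xn1_frob P Q : (X1 (n * p) %| P ^+ p - Q ^+ p) = (X1 n %| P - Q).
Proof. by rewrite Xn1_frob -expr_polyB dvdp_pexp2r. Qed.

Definition circ_red (g : {'GL_(n * p)[F]}) : {'GL_n[F]} := circ_poly n (poly_circ g).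

Lemma circ_red_poly P : coprimep P (X1 (n * p)) -> P.[1] = 1 ->
  circ_red (circ_poly (n * p) P) = circ_poly n P.
Proof.
move=> coP P1; have [cog _ gE] := poly_circP np_gt0 (circ_poly_units1 np_gt0 coP P1).
apply/eqP; rewrite circ_poly_eq // -?coprime_Xn1_frob //.
have : circ_poly (n * p) (poly_circ (circ_poly (n * p) P)) == circ_poly (n * p) P by rewrite gE.
rewrite circ_poly_eq //; apply: dvdp_trans; rewrite Xn1_frob.
by rewrite -(prednK p_gt0) exprS dvdp_mulr.
Qed.

Lemma circ_redM : {in C1 (n * p) &, {morph circ_red : g h / (g * h)%g}}.
Proof.
move=> g h /(poly_circP np_gt0)[cog g1 gE] /(poly_circP np_gt0)[coh h1 hE].
rewrite -{1}gE -{1}hE -circ_polyM // circ_red_poly ?coprimepMl ?cog //.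
  by rewrite circ_polyM // -coprime_Xn1_frob.
by rewrite hornerM g1 h1 mulr1.
Qed.

Lemma circ_red_im : circ_red @: C1 (n * p) = C1 n.
Proof.
apply/setP=> g; apply/imsetP/idP => [[h /(poly_circP np_gt0)[coh h1 _] ->]|Cg].
  by apply: circ_poly_units1; rewrite -?coprime_Xn1_frob.
have [cog g1 gE] := poly_circP n_gt0 Cg; rewrite -coprime_Xn1_frob in cog.
by exists (circ_poly (n * p) (poly_circ g)); rewrite ?circ_poly_units1 ?circ_red_poly.
Qed.

Lemma circ_red_eq1 : {in C1 (n * p), forall g, circ_red g = 1%g <-> (g ^+ p)%g = 1%g}.
Proof.
move=> g /(poly_circP np_gt0)[cog g1 gE].
have eq1 : (circ_red g == 1%g) = ((g ^+ p)%g == 1%g).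
  rewrite -{2}gE -circ_polyX // -!circ_poly1 // !circ_poly_eq ?coprimep_expl ?coprime1p //.
    by rewrite -dvdp_Xn1_frob expr1n.
  by rewrite -coprime_Xn1_frob.
by split=> /eqP; [rewrite eq1 | rewrite -eq1] => /eqP.
Qed.

Lemma circ_red_gen k : circ_red (x (n * p) ^+ k)%g = (x n ^+ k)%g.
Proof.
rewrite -!circ_poly_genX // circ_red_poly ?coprimep_expl ?coprimeX_Xn1 //.
by rewrite !hornerE expr1n.
Qed.

(** The kernel of the reduction consists of the classes of 1 + (X^n - 1) u with deg u < np - n. All
    of these are units, X^n - 1 being nilpotent modulo its p-th power, and take the value 1 at 1. *)
Lemma card_circ_Ldiv : #|'Ldiv_p(C1 (n * p))%g| = (#|F| ^ (n * p - n))%N.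
Proof.
pose f (c : 'rV[F]_(n * p - n)) := 1 + X1 n * rVpoly c.
have f_co c : coprimep (f c) (X1 (n * p)).
  rewrite coprime_Xn1_frob; apply/Bezout_eq1_coprimepP; exists (1, - rVpoly c) => /=.
  by rewrite /f mul1r mulNr [_ * X1 n]mulrC addrK.
have f1 c : (f c).[1] = 1.
  by rewrite /f hornerD hornerM hornerC !hornerE expr1n subrr mul0r addr0.
rewrite -[RHS](_ : #|[set circ_poly (n * p) (f c) | c : 'rV[F]_(n * p - n)]| = _); last first.
  rewrite card_imset ?card_mx ?mul1n // => c c' /eqP; rewrite circ_poly_eq //.
  rewrite /f opprD addrACA subrr add0r -mulrBr -raddfB /= => /dvdp_leq; rewrite size_Xn1 //.
  set u := rVpoly _; have [u0 _|u_neq0] := eqVneq u 0.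
    by apply/eqP; rewrite -subr_eq0 -[c - c']rVpolyK -/u u0 raddf0.
  rewrite mulf_neq0 ?Xn1_neq0 // => /(_ isT).
  rewrite size_mul ?Xn1_neq0 // size_Xn1 // addSn /= leqNgt ltnS => /negP[].
  apply: leq_trans (leq_add (leqnn n) (size_poly _ _)) _.
  by rewrite subnKC // leq_pmulr.
congr #|pred_of_set _|; apply/setP=> g; apply/LdivP/imsetP; last first.
  case=> c _ ->; split; first exact: circ_poly_units1.
  apply/circ_red_eq1; first exact: circ_poly_units1.
  rewrite circ_red_poly //; apply/eqP; rewrite -circ_poly1 // circ_poly_eq ?coprime1p //.
    by rewrite /f addrAC subrr add0r dvdp_mulr.
  by rewrite -coprime_Xn1_frob.
case=> Cg gp; have [cog g1 gE] := poly_circP np_gt0 Cg.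
have red1 : circ_red g = 1%g by apply/circ_red_eq1.
move/eqP: red1; rewrite /circ_red.
rewrite -circ_poly1 // circ_poly_eq ?coprime1p -?coprime_Xn1_frob //.
case/dvdpP=> u /(canRL (subrK _)) gu.
have size_u : (size u <= n * p - n)%N.
  have [->|u_neq0] := eqVneq u 0; first by rewrite size_poly0.
  have : (size (poly_circ g - 1)%R <= n * p)%N.
    rewrite (leq_trans (size_polyD _ _)) // size_polyN geq_max size_poly size_poly1.
    by rewrite np_gt0.
  rewrite gu addrK size_mul ?Xn1_neq0 // size_Xn1 // addnS /= => le_un.
  by rewrite leq_subRL ?leq_pmulr // addnC.
exists (poly_rV u) => //; rewrite -gE; congr circ_poly.
by rewrite /f poly_rV_K // gu mulrC addrC.
Qed.

(** Differentiate P^p - X^k = u (X^(np) - 1): p-th powers have derivative 0, so X^(np) - 1 divides k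
    X^(k-1), which is impossible for k invertible in F. *)
Lemma circ_genX_frob g k : g \in C1 (n * p) -> (g ^+ p = x (n * p) ^+ k)%g -> (p %| k)%N.
Proof.
case/(poly_circP np_gt0)=> cog _ gE; rewrite -{1}gE -circ_polyX // -circ_poly_genX // => /eqP.
rewrite circ_poly_eq ?coprimep_expl ?coprimeX_Xn1 // => /dvdpP[u].
have charP : p \in [pchar {poly F}] by rewrite pchar_poly.
move/(congr1 (@deriv _)); rewrite derivB derivM derivB !derivXn -polyC1 derivC subr0 polyC1.
rewrite deriv_exp mulrn_pchar // [in RHS]mulrnA [X in _ = _ + _ * X]mulrn_pchar // mulr0 addr0.
rewrite sub0r => Xk; apply: contraT => pk.
have k_neq0 : k%:R != 0 :> F by rewrite -(dvdn_pcharf charFp).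
have : X1 (n * p) %| 'X^(k.-1).
  rewrite -(dvdpZr _ _ k_neq0) scaler_nat -dvdpNr Xk dvdp_mull //.
have coX : coprimep (X1 (n * p)) 'X^(k.-1) by rewrite coprimep_sym coprimep_expl ?coprimeX_Xn1.
by move/coprimep_dvdl/(_ coX); rewrite coprimepp size_Xn1 // eqSS eqn0Ngt np_gt0.
Qed.

End ReduceCirculant.

(** * Proper prime powers *)

Section NonPrime.
Variables (F : finFieldType) (p : nat).
Hypotheses (charFp : p \in [pchar F]) (npF : ~~ prime #|F|).
Local Notation d := #|F|.
Local Notation n := (d.-1 * p)%N.
Local Notation m := d.-1.

Let p_pr : prime p. Proof. exact: pcharf_prime charFp. Qed.
Let p_gt0 : (0 < p)%N. Proof. exact: prime_gt0. Qed.
Let d_gt2 : (2 < d)%N.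
Proof. by move: npF (finNzRing_gt1 F); case: #|F| => [|[|[|]]]. Qed.
Let m_gt1 : (1 < m)%N. Proof. by rewrite -ltnS prednK // ltnW // ltnW. Qed.
Let dE : d = m.+1. Proof. by rewrite prednK // ltnW // ltnW. Qed.
Let n_gt0 : (0 < n)%N. Proof. by rewrite muln_gt0 p_gt0 ltnW. Qed.
Let m_lt : (m < n)%N. Proof. by rewrite ltn_Pmulr ?prime_gt1 // ltnW. Qed.

(** The d-th power map is additive, fixes F, and fixes the class of X because X^m = 1; hence it is
    the identity modulo X^m - 1. *)
Lemma dvdp_frob_sub (P : {poly F}) : 'X^m - 1 %| P ^+ d - P.
Proof.
have charP : p \in [pchar {poly F}] by rewrite pchar_poly.
elim/poly_ind: P => [|P c IHP]; first by rewrite expr0n dE /= subrr dvdp0.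
rewrite exprDn_pchar ?(eq_pnat _ (pcharf_eq charP)) ?pchar_nat_card //.
rewrite -rmorphXn /= expf_card opprD addrACA subrr addr0 exprMn.
have -> : P ^+ d * 'X ^+ d - P * 'X = (P ^+ d - P) * 'X ^+ d + P * 'X * ('X^m - 1).
  by rewrite {2 4}dE exprS; ring.
by apply: dvdp_add; [apply: dvdp_mulr | apply: dvdp_mull].
Qed.

(** Raising P^d = P modulo X^m - 1 to the p-th power gives P^(dp) = P^p modulo X^(mp) - 1. *)
Lemma circ_units1_exponent g : g \in circ_units1 F n -> (g ^+ n)%g = 1%g.
Proof.
move=> Cg; have [cog _ gE] := poly_circP n_gt0 Cg.
have : (g ^+ (d * p) == g ^+ p)%g.
  rewrite -gE -!circ_polyX // circ_poly_eq ?coprimep_expl //.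
  rewrite [poly_circ g ^+ (d * p)]exprM.
  by rewrite dvdp_Xn1_frob // dvdp_frob_sub.
have -> : (d * p = p + m * p)%N by rewrite {1}dE mulSn.
by rewrite expgD => /eqP/(canRL (mulKg _)); rewrite mulVg.
Qed.

Lemma circ_quotient_exponent C :
  C \in (circ_units1_group F n / <[circ_gen F n]>)%g -> (C ^+ n)%g = 1%g.
Proof.
by case/morphimP=> g Ng Cg ->; rewrite -morphX // circ_units1_exponent // morph1.
Qed.

Lemma zmod_isog_exponent (A : zmodType) (gT : finGroupType) (G : {group gT}) e :
  {in G, forall g, (g ^+ e)%g = 1%g} -> zmod_isog A G -> forall a : A, a *+ e = 0.
Proof.
move=> Ge [f [fM f_inj fG]] a; apply: f_inj.
have f0 : f 0 = 1%g by apply: (mulgI (f 0)); rewrite -fM addr0 mulg1.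
have fX b k : f (b *+ k) = (f b ^+ k)%g.
  by elim: k => [|k IHk]; rewrite ?mulr0n ?f0 // mulrS fM IHk expgS.
by rewrite fX f0 Ge //; apply/fG; exists a.
Qed.

Local Notation chi u := ((u %% n == m)%N%:R : 'Z_d).

(** p divides d and n but not m = d - 1, so dv is never m modulo n. *)
Let chi_mul v : chi (d * v)%N = 0.
Proof.
case: eqP => // dv; have pd : (p %| d)%N by apply: pchar_dvd_card.
have : (p %| m)%N by rewrite -dv /dvdn modn_dvdm ?dvdn_mull // -/(dvdn p _) dvdn_mulr.
have := pd; rewrite {1}dE -addn1 => pm1 pm.
by move: pm1; rewrite dvdn_addr // dvdn1 => /eqP p1; move: p_pr; rewrite p1.
Qed.

Let Zd_mulrn (y : 'Z_d) : y *+ d = 0.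
Proof. by rewrite -mulr_natr pchar_Zp ?mulr0 // ltnW. Qed.

(** d is coprime to m, so d | mp would give d | p, which a proper power of p excludes. *)
Let n_Zd : n%:R != 0 :> 'Z_d.
Proof.
apply/eqP=> n0; have d_n : (d %| n)%N.
  by rewrite /dvdn -(val_Zp_nat (ltnW d_gt2)) n0.
have co_dm : coprime d m by rewrite {1}dE coprimeSn.
have : (d %| p)%N by rewrite -(Gauss_dvdr _ co_dm).
have [_ p_div] := primeP p_pr; case/p_div/orP => /eqP d_eq.
  by move: d_gt2; rewrite d_eq.
by move: npF; rewrite d_eq p_pr.
Qed.

Lemma Sigma_not_torsion (A : zmodType) (E : nat -> A) :
  presentation n d [:: 0%N] E -> ~ (forall a : A, a *+ n = 0).
Proof.
move=> presE A_n; have [|||h hE] := presentation_lift (g := fun v => chi v) n_gt0 presE.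
- by rewrite mod0n ltn_eqF // ltnW.
- by move=> v; rewrite modn_mod.
- by move=> v; rewrite Zd_mulrn big_seq1 addn0 chi_mul.
have /eqP := congr1 h (A_n (E m)); rewrite raddfMn hE modn_small // eqxx raddf0.
by rewrite (negPf n_Zd).
Qed.

Lemma Sandpile_not_torsion (A : zmodType) (E : nat -> A) :
  presentation n d (iota 0 d) E -> ~ (forall a : A, a *+ n = 0).
Proof.
move=> presE A_n.
(* Differences of chi over the d offsets telescope to chi(d(v+1)) - chi(dv) = 0. The value at 0
   vanishes because m > 1, and E_(m-1) is sent to 1. *)
have [|||h hE] := presentation_lift (g := fun v => chi v.+1 - chi v) n_gt0 presE.
- by rewrite mod0n modn_small ?(ltn_trans m_gt1) // !ltn_eqF ?subr0 // ltnW.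
- move=> v; have -> : ((v %% n).+1 %% n = v.+1 %% n)%N by rewrite -addn1 modnDml addn1.
  by rewrite modn_mod.
- move=> v; rewrite Zd_mulrn -[d in iota 0 d]subn0 big_mkord.
  rewrite (eq_bigr (fun i : 'I_d => chi (d * v + i.+1)%N - chi (d * v + i)%N)); last first.
    by move=> i _; rewrite addnS.
  have := telescope_sumr (fun i => chi (d * v + i)%N) (leq0n d); rewrite big_mkord => ->.
  by rewrite -mulnSr addn0 !chi_mul subrr.
have m1 : (m.-1.+1 = m)%N by rewrite prednK // ltnW.
have m1_lt : (m.-1 < m)%N by rewrite m1.
have /eqP := congr1 h (A_n (E m.-1)); rewrite raddfMn hE.
have -> : (m.-1.+1 %% n = m)%N by rewrite m1 modn_small.
by rewrite eqxx (modn_small (ltn_trans m1_lt m_lt)) (ltn_eqF m1_lt) subr0 raddf0 (negPf n_Zd).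
Qed.

End NonPrime.

(** * Assembling the cases *)

Local Notation C1 F n := (circ_units1_group F n).
Local Notation C1X F n := (circ_units1_group F n / <[circ_gen F n]>)%G.

Lemma coprime_isog (F : finFieldType) n : (0 < n)%N -> coprime n #|F| ->
  (forall (A : zmodType) (E : nat -> A),
     presentation n #|F| [:: 0%N] E -> zmod_isog A (C1 F n)) /\
  (forall (A : zmodType) (E : nat -> A),
     presentation n #|F| (iota 0 #|F|) E -> zmod_isog A (C1X F n)).
Proof.
move=> n_gt0 co_nq.
have [K [emb [zeta [r [prim_zeta cardK fixK]]]]] := exists_prim_root_extension n_gt0 co_nq.
split=> A E presE.
  exact: (coprime_Sigma_isog n_gt0 prim_zeta fixK co_nq cardK presE).
exact: (coprime_Sandpile_isog n_gt0 prim_zeta fixK co_nq cardK presE).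
Qed.

Lemma prime_isog (F : finFieldType) n : prime #|F| -> (0 < n)%N ->
  (forall (A : zmodType) (E : nat -> A),
     presentation n #|F| [:: 0%N] E -> zmod_isog A (C1 F n)) /\
  (forall (A : zmodType) (E : nat -> A),
     presentation n #|F| (iota 0 #|F|) E -> zmod_isog A (C1X F n)).
Proof.
move=> p_pr; set p := #|F| in p_pr *.
have charFp : p \in [pchar F] by apply: (card_finPcharP (n := 1)); rewrite ?expn1.
have [N] := ubnP n; elim: N n => // N IHN n; rewrite ltnS => n_N n_gt0.
have [co_np|] := boolP (coprime n p); first exact: coprime_isog.
rewrite coprime_sym prime_coprime // negbK => /dvdnP[n' n_n'].
have n'_gt0 : (0 < n')%N by move: n_gt0; rewrite n_n' muln_gt0 => /andP[].
have [|IH1 IH2] := IHN n' _ n'_gt0.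
  by apply: leq_trans n_N; rewrite n_n' ltn_Pmulr // prime_gt1.
rewrite n_n'; split=> A E presE.
  have [E' presE'] := Sigma_presentation p n'_gt0.
  apply: (zmod_isog_reduction (h := circ_red (p := p) (n := n')) p_pr n'_gt0 _ _ _ _
     presE presE' (IH1 _ _ presE')) => //.
  - by move=> i; rewrite inE => /eqP->; apply: prime_gt0.
  - by rewrite inE.
  - exact: circ_units1_abelian.
  - exact: circ_redM.
  - exact: circ_red_im.
  - exact: circ_red_eq1.
  - by rewrite card_circ_Ldiv // subn0.
have [E' presE'] := Sandpile_presentation p n'_gt0.
have p_gt1 := prime_gt1 p_pr; have p1_gt0 : (0 < p.-1)%N by rewrite ltn_predRL.
pose red := @red_coset _ _ (@circ_red F p n') (circ_gen F (n' * p)) (circ_gen F n').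
have cC := circ_units1_abelian F; have gC := circ_gen_units1 F.
have redM := circ_redM n'_gt0 charFp; have red_im := circ_red_im n'_gt0 charFp.
have red1 := circ_red_eq1 n'_gt0 charFp; have redX := circ_red_gen n'_gt0 charFp.
have Xfrob := circ_genX_frob n'_gt0 charFp.
(* The pivot offset must be nonzero here: in block 0 offset 0 is E_0 = 0, which the relation cannot
   eliminate. *)
apply: (zmod_isog_reduction (i0 := p.-1) (h := red) p_pr n'_gt0 _ _ _ _
   presE presE' (IH2 _ _ presE')).
- exact: iota_uniq.
- by move=> i; rewrite mem_iota.
- by rewrite mem_iota /= prednK // ltnW.
- by move=> p1; rewrite p1 in p1_gt0.
- exact: quotient_abelian.
- exact: (red_cosetM (cC _) (cC _) (gC _) (gC _) redM red_im redX).
- exact: (red_coset_im (cC _) (cC _) (gC _) (gC _) redM red_im redX).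
- exact: (red_coset_eq1 (cC _) (cC _) (gC _) (gC _) redM red_im red1 redX Xfrob).
have oX : #[circ_gen F (n' * p)]%g = (#[circ_gen F n']%g * p)%N.
  by rewrite !circ_gen_order // muln_gt0 n'_gt0 ltnW.
have := card_quotient_Ldiv (cC _) (cC _) (gC _) (gC _) redM red_im red1 redX Xfrob oX.
have lt_n : (0 < n' * p - n')%N by rewrite subn_gt0 ltn_Pmulr.
(* Passing to the quotient by <X> divides the p-torsion by p, matching the correction for the
   nonzero pivot offset. *)
rewrite (card_circ_Ldiv n'_gt0 charFp) -/p -[in RHS](prednK lt_n) expnS => /eqP.
rewrite eqn_pmul2l ?(ltnW p_gt1) // => /eqP->; congr (_ ^ _)%N.
by rewrite -lt0n p1_gt0 subn1.
Qed.

Local Close Scope ring_scope.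

Theorem theorem3p2 (d : nat) (F : finFieldType) (cardF : #|F| = d) :
  (prime d -> forall n : nat, 0 < n ->
     zmod_isog (Sigma n d) (circ_units1_group F n) /\
     zmod_isog (Sandpile n d) (circ_units1_group F n / <[circ_gen F n]>)%G)
  /\
  ((exists p k : nat, [/\ prime p, 0 < k & d = p ^ k]) -> ~~ prime d ->
     [/\ forall n : nat, 0 < n -> gcdn n d = 1 ->
           zmod_isog (Sigma n d) (circ_units1_group F n) /\
           zmod_isog (Sandpile n d) (circ_units1_group F n / <[circ_gen F n]>)%G,
         exists n : nat, [/\ 0 < n, gcdn n d <> 1 &
           ~ zmod_isog (Sigma n d) (circ_units1_group F n)]
       & exists n : nat, [/\ 0 < n, gcdn n d <> 1 &
           ~ zmod_isog (Sandpile n d) (circ_units1_group F n / <[circ_gen F n]>)%G]]).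
Proof.
rewrite -{}cardF; split=> [p_pr n n_gt0|[p [k [p_pr k_gt0 cardF]]] npF].
  have [Sig_iso San_iso] := prime_isog p_pr n_gt0.
  have [E presE] := Sigma_presentation #|F| n_gt0.
  have [E' presE'] := Sandpile_presentation #|F| n_gt0.
  by split; [apply: Sig_iso presE | apply: San_iso presE'].
have charFp : p \in [pchar F]%R by apply: card_finPcharP cardF p_pr.
have m_gt0 : 0 < #|F|.-1 by move: (finNzRing_gt1 F); case: #|F| => [|[]].
have n_gt0 : 0 < #|F|.-1 * p by rewrite muln_gt0 m_gt0 prime_gt0.
have gcd_neq1 : gcdn (#|F|.-1 * p) #|F| <> 1.
  move=> gcd1; have := dvdn_gcd p (#|F|.-1 * p) #|F|.
  rewrite gcd1 dvdn_mull // pchar_dvd_card // dvdn1 => /eqP p1.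
  by move: p_pr; rewrite p1.
split=> [n n'_gt0 /eqP co_nd||].
- have [Sig_iso San_iso] := coprime_isog n'_gt0 co_nd.
  have [E presE] := Sigma_presentation #|F| n'_gt0.
  have [E' presE'] := Sandpile_presentation #|F| n'_gt0.
  by split; [apply: Sig_iso presE | apply: San_iso presE'].
- exists (#|F|.-1 * p); split=> // iso.
  have [E presE] := Sigma_presentation #|F| n_gt0.
  apply: (Sigma_not_torsion charFp npF presE); apply: zmod_isog_exponent iso => g.
  exact: circ_units1_exponent.
- exists (#|F|.-1 * p); split=> // iso.
  have [E presE] := Sandpile_presentation #|F| n_gt0.
  apply: (Sandpile_not_torsion charFp npF presE); apply: zmod_isog_exponent iso => g.
  exact: circ_quotient_exponent.
Qed.
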